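(* Let $\mathfrak R$ be a locally extended affine root system (LEARS) in $V$, let $V'$ be a reflectable subspace, so $V=V'\oplus V^0$, and let $\Delta=\Delta_{V'}\subset V'$ be the associated locally finite irreducible root system, $S_\alpha\subset V^0$ ($\alpha\in\Delta$) the associated subsets and $G=\langle\bigcup_{\alpha\in\Delta}S_\alpha\rangle$. Then $S_\alpha$ depends only on whether $\alpha$ is short, long or extra long: there are nonempty subsets $S$, $L$ (present only if $\Delta_{lg}\ne\emptyset$) and $E$ (present only if $\Delta_{ex}\neq\emptyset$) of $V^0$ with $S_\alpha=S$, $L$, $E$ for $\alpha\in\Delta_{sh}$, $\Delta_{lg}$, $\Delta_{ex}$ respectively. One has $E\subset L\subset S$ (omitting those sets that are not present), $\langle S\rangle=G$, $S$ spans $V^0$ over $\mathbb Q$, and each of $L$, $E$ also spans $V^0$ if it is present. Moreover: (i) If $\Delta=A_{\mathfrak I}$, then $\mathfrak R=\Delta+S$, where $S$ is a pointed reflection space of $V^0$, and if $\Delta\neq A_1$, then $S=G$. (ii) If $\Delta=B_{\mathfrak I}$ ($|\mathfrak I|\ge2$), then $\mathfrak R=(\Delta_{sh}+S)\sqcup(\Delta_{lg}+L)$, where $S$ and $L$ are pointed reflection spaces of $V^0$ satisfying $2S+L\subset L$ and $S+L\subset S$, and if $|\mathfrak I|>2$, then $L$ is a subgroup of $V^0$. (iii) If $\Delta=C_{\mathfrak I}$ ($|\mathfrak I|\ge2$), then $\mathfrak R=(\Delta_{sh}+S)\sqcup(\Delta_{lg}+L)$, where $S$ and $L$ are pointed reflection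 spaces of $V^0$ satisfying $2S+L\subset L$ and $S+L\subset S$, and if $|\mathfrak I|>2$, then $S=G$. (iv) If $\Delta=D_{\mathfrak I}$, $E_6$, $E_7$ or $E_8$, then $\mathfrak R=\Delta+G$. (v) If $\Delta=BC_{\mathfrak I}$ with $|\mathfrak I|\geq2$, then $\mathfrak R=(\Delta_{sh}+S)\sqcup(\Delta_{lg}+L)\sqcup(\Delta_{ex}+E)$, where $S$ and $L$ are pointed reflection spaces of $V^0$ and $E$ is a reflection space of $V^0$ satisfying $2S+L\subset L$, $S+L\subset S$, $4S+E\subset E$, $S+E\subset S$, $2L+E\subset E$ and $L+E\subset L$, and if $|\mathfrak I|>2$, then $L$ is a subgroup of $V^0$. Also, if $\mathfrak R$ is reduced, then $E\cap2S=\emptyset$. (vi) If $\Delta=BC_1$, then $\mathfrak R=(\Delta_{sh}+S)\sqcup(\Delta_{ex}+E)$, where $S$ is a pointed reflection space of $V^0$ and $E$ is a reflection space of $V^0$ satisfying $4S+E\subset E$ and $S+E\subset S$. Also, if $\mathfrak R$ is reduced, then $E\cap 2S=\emptyset$. (vii) If $\Delta=F_4$, then $\mathfrak R=(\Delta_{sh}+G)\sqcup(\Delta_{lg}+L)$, where $L$ is a subgroup of $V^0$ satisfying $2G\subset L$. (viii) If $\Delta=G_2$, then $\mathfrak R=(\Delta_{sh}+G)\sqcup(\Delta_{lg}+L)$, where $L$ is a subgroup of $V^0$ satisfying $3G\subset L$. Conversely, let $\Delta$ be a locally finite irreducible root system in a $\mathbb Q$-vector space $V'$ with positive definite form, let $V^0$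 be a $\mathbb Q$-vector space, and extend the form to $V=V'\oplus V^0$ so that $V^0$ is the radical. If nonempty subsets $E\subset L\subset S$ of $V^0$ (those present for $\Delta$), with $S$ spanning $V^0$ and $G=\langle S\rangle$, satisfy the conditions listed for the type of $\Delta$ in (i)–(viii) (with $S=G$ in (iv), (vii), (viii)), then the set $\mathfrak R$ defined there is a LEARS in $V$ of type $\Delta$.
   Context: LEARS: let $V$ be a vector space over $\mathbb Q$ with a positive semidefinite symmetric bilinear form $(\cdot,\cdot)$. A nonempty subset $\mathfrak R\subset V$ is a locally extended affine root system (LEARS) if (A1) $(\alpha,\alpha)\ne0$ for all $\alpha\in\mathfrak R$ and $\mathfrak R$ spans $V$; (A2) $\langle\alpha,\beta\rangle:=\frac{2(\alpha,\beta)}{(\beta,\beta)}\in\mathbb Z$ for $\alpha,\beta\in\mathfrak R$; (A3) $\sigma_\alpha(\beta):=\beta-\langle\beta,\alpha\rangle\alpha\in\mathfrak R$ for $\alpha,\beta\in\mathfrak R$; (A4) $\mathfrak R=\mathfrak R_1\cup\mathfrak R_2$ and $(\mathfrak R_1,\mathfrak R_2)=0$ imply $\mathfrak R_1=\emptyset$ or $\mathfrak R_2=\emptyset$. It is reduced if $2\alpha\notin\mathfrak R$ for all $\alpha\in\mathfrak R$. $V^0=\{x\in V\mid (x,y)=0\ \forall y\in V\}$ is the radical. $\langle X\rangle$ (for a single set $X$) denotes the additive subgroup generated by $X$. A locally finite irreducible root system is a LEARS for which the form is positive definite. These are: the finite irreducible root systems $A_\ell$ ($\ell\ge1$), $B_\ell$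 ($\ell\ge1$, $B_1=A_1$), $C_\ell$ ($\ell\ge2$, $C_2=B_2$), $D_\ell$ ($\ell\ge4$), $E_6,E_7,E_8,F_4,G_2$, $BC_\ell$ ($\ell\ge1$), and for infinite $\mathfrak I$, with $\{\epsilon_i\}_{i\in\mathfrak I}$ orthonormal, $A_{\mathfrak I}=\{\epsilon_i-\epsilon_j\mid i\ne j\}$ (in its span), $B_{\mathfrak I}=\{\pm\epsilon_i,\pm(\epsilon_i\pm\epsilon_j)\mid i\neq j\}$, $C_{\mathfrak I}=\{\pm(\epsilon_i\pm\epsilon_j),\pm2\epsilon_i\mid i\ne j\}$, $D_{\mathfrak I}=\{\pm(\epsilon_i\pm\epsilon_j)\mid i\ne j\}$, $BC_{\mathfrak I}=B_{\mathfrak I}\cup C_{\mathfrak I}$. The notation $X_{\mathfrak I}$ also covers finite $\mathfrak I$, meaning the finite system $X_\ell$ of rank $\ell=|\mathfrak I|$. $\Delta_{sh}$: roots of minimal length (short); $\Delta_{ex}$: roots that are twice a short root (extra long); $\Delta_{lg}$: all other roots (long). Let $\bar{\ }:V\to\bar V=V/V^0$ be the projection; $\bar{\mathfrak R}$ is a locally finite irreducible root system in $\bar V$. Put $\bar{\mathfrak R}^{\mathrm{red}}=\bar{\mathfrak R}$ if $\bar{\mathfrak R}$ is reduced and $\{\alpha\in\bar{\mathfrak R}\mid\frac12\alpha\notin\bar{\mathfrak R}\}$ otherwise. A reflectable base of a reduced locally finite irreducible root system $\Phi$ is a vector space basis $\Pi\subset\Phi$ of its span such that every $\alpha\in\Phi$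 has the form $\sigma_{\alpha_1}\cdots\sigma_{\alpha_k}(\alpha_{k+1})$ with all $\alpha_i\in\Pi$ (such bases always exist). Choose a reflectable base $\Pi$ of $\bar{\mathfrak R}^{\mathrm{red}}$ and a preimage $\alpha\in\mathfrak R$ of each $\bar\alpha\in\Pi$; the span $V'$ of these preimages is called a reflectable subspace, and $V=V'\oplus V^0$. Put $\Delta=\Delta_{V'}=\{\alpha\in V'\mid \alpha+s\in\mathfrak R\text{ for some }s\in V^0\}$ (a locally finite irreducible root system in $V'$ isomorphic to $\bar{\mathfrak R}$; $\mathfrak R$ is said to have type $\Delta$) and $S_\alpha=\{s\in V^0\mid\alpha+s\in\mathfrak R\}$ for $\alpha\in\Delta$, so $\mathfrak R=\bigsqcup_{\alpha\in\Delta}(\alpha+S_\alpha)$. A subset $E$ of an abelian group is a reflection space if $E-2E\subset E$, where $E-2E=\{x-2y\mid x,y\in E\}$; it is pointed if $0\in E$. Here $kX=\{kx\mid x\in X\}$, $X+Y=\{x+y\}$. *)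

(* Defs.v *)
From HB Require Import structures.
From mathcomp Require Import all_boot all_order all_algebra.
From mathcomp Require Import ring_quotient generic_quotient sesquilinear.
From mathcomp Require Import boolp classical_sets functions cardinality fsbigop.

Set Implicit Arguments.
Unset Strict Implicit.
Unset Printing Implicit Defensive.

Import GRing.Theory Num.Theory.

Local Open Scope classical_set_scope.
Local Open Scope card_scope.
Local Open Scope ring_scope.

Section LinearAlgebra.
Variable V : lmodType rat.
Implicit Types (A B X H W : set V) (k : rat).

Definition sumset A B : set V := [set a + b | a in A & b in B].
Definition dilate k A : set V := [set k *: a | a in A].

Definition subgroup H := H 0 /\ forall x y, H x -> H y -> H (x - y).
Definition subspace W :=
  [/\ W 0, forall x y, W x -> W y -> W (x + y) & forall k x, W x -> W (k *: x)].

Definition generated X : set V := smallest subgroup X.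
Definition lin_span X : set V := smallest subspace X.

Definition direct_sum W1 W2 := sumset W1 W2 = [set: V] /\ W1 `&` W2 = [set 0].

Definition lin_indep X :=
  forall (s : seq V) (c : V -> rat), uniq s -> (forall x, x \in s -> X x) ->
    \sum_(x <- s) c x *: x = 0 -> forall x, x \in s -> c x = 0.

Definition is_basis X W := lin_indep X /\ lin_span X = W.

(* Reflection spaces contained in the additive group W. *)
Definition reflection_space W X :=
  X `<=` W /\ sumset X (dilate (- 2) X) `<=` X.
Definition pointed_reflection_space W X := reflection_space W X /\ X 0.

End LinearAlgebra.

Section RootSystems.
Variables (V : lmodType rat) (form : V -> V -> rat).
Implicit Types (R Phi Pi W : set V).

Definition cartan (a b : V) : rat := 2 * form a b / form b b.
Definition reflection (a b : V) : V := b - cartan b a *: a.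

Definition radical : set V := [set x | forall y, form x y = 0].

(* R is a LEARS in the subspace W equipped with the restriction of the form
   (whose bilinearity and symmetry are carried by the type of the form). *)
Record is_lears W R : Prop := {
  lears_subspace : subspace W;
  lears_psd : forall x, W x -> 0 <= form x x;
  lears_neq0 : R !=set0;
  lears_anisotropic : forall a, R a -> form a a != 0;
  lears_span : lin_span R = W;
  lears_integral : forall a b, R a -> R b -> cartan a b \is a Num.int;
  lears_reflection : forall a b, R a -> R b -> R (reflection a b);
  lears_irreducible : forall R1 R2, R = R1 `|` R2 ->
    (forall a b, R1 a -> R2 b -> form a b = 0) -> R1 = set0 \/ R2 = set0
}.

Definition is_lf_irr_root_system W Phi :=
  is_lears W Phi /\ forall x, W x -> x != 0 -> 0 < form x x.

Definition is_reduced R := forall a, R a -> ~ R (2 *: a).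

Definition red_part Phi : set V :=
  [set a | Phi a /\ (is_reduced Phi \/ ~ Phi (2^-1 *: a))].

Definition short_roots Phi : set V :=
  [set a | Phi a /\ forall b, Phi b -> form a a <= form b b].
Definition extra_long_roots Phi : set V :=
  [set a | Phi a /\ exists2 b, short_roots Phi b & a = 2 *: b].
Definition long_roots Phi : set V :=
  Phi `\` (short_roots Phi `|` extra_long_roots Phi).

Definition is_reflectable_base Phi Pi :=
  [/\ Pi `<=` Phi, is_basis Pi (lin_span Phi)
    & forall a, Phi a -> exists (s : seq V) (b : V),
        [/\ forall x, x \in s -> Pi x, Pi b & a = foldr reflection b s]].

End RootSystems.

Section Projection.
Variables (V : lmodType rat) (form : {symmetric V}).

Definition radical_pred : {pred V} := fun x => `[< radical form x >].

Lemma form_subl x y z : form (x - y) z = form x z - form y z.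
Proof. exact: linearBl. Qed.

Lemma form_scalel k x z : form (k *: x) z = k * form x z.
Proof. exact: linearZl_LR. Qed.

Lemma radical_pred_zmod_closed : zmod_closed radical_pred.
Proof.
split=> [|x y /asboolP xr /asboolP yr]; apply/asboolP => z.
  exact: linear0l.
by rewrite form_subl xr yr subrr.
Qed.

HB.instance Definition _ :=
  GRing.isZmodClosed.Build V radical_pred radical_pred_zmod_closed.

Definition Vbar := Quotient.quot radical_pred.
HB.instance Definition _ := GRing.Zmodule.on Vbar.

Definition bar (x : V) : Vbar := \pi_(Quotient.quot radical_pred)%qT x.

Lemma bar_eq x y : bar x = bar y <-> radical form (x - y).
Proof.
split=> [/eqP|h]; rewrite /bar.
  by rewrite -Quotient.idealrBE => /asboolP.
by apply/eqP; rewrite -Quotient.idealrBE; apply/asboolP.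
Qed.

Lemma bar_repr (x : Vbar) : bar (repr x) = x.
Proof. exact: reprK. Qed.

Lemma barD : {morph bar : x y / x + y}.
Proof. exact: raddfD. Qed.

Definition scale_bar (k : rat) (x : Vbar) : Vbar := bar (k *: repr x).

Lemma scale_barE k x : scale_bar k (bar x) = bar (k *: x).
Proof.
apply/bar_eq => y; rewrite -scalerBr form_scalel.
have /bar_eq -> : bar (repr (bar x)) = bar x by rewrite bar_repr.
by rewrite mulr0.
Qed.

Lemma scale_barA k l x : scale_bar k (scale_bar l x) = scale_bar (k * l) x.
Proof. by rewrite -(bar_repr x) !scale_barE scalerA. Qed.

Lemma scale_bar1 : left_id 1 scale_bar.
Proof. by move=> x; rewrite -(bar_repr x) scale_barE scale1r. Qed.

Lemma scale_barDr : right_distributive scale_bar +%R.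
Proof.
move=> k x y; rewrite -(bar_repr x) -(bar_repr y) -barD !scale_barE.
by rewrite scalerDr barD.
Qed.

Lemma scale_barDl x : {morph scale_bar^~ x : k l / k + l}.
Proof. by move=> k l; rewrite -(bar_repr x) !scale_barE scalerDl barD. Qed.

HB.instance Definition _ := GRing.Zmodule_isLmodule.Build rat Vbar
  scale_barA scale_bar1 scale_barDr scale_barDl.

Definition bar_form (x y : Vbar) : rat := form (repr x) (repr y).

Lemma bar_formE x y : bar_form (bar x) (bar y) = form x y.
Proof.
have h z : radical form (repr (bar z) - z) by apply/bar_eq; rewrite bar_repr.
rewrite /bar_form; transitivity (form x (repr (bar y))).
  by apply/eqP; rewrite -subr_eq0 -form_subl h.
rewrite (hermitian_subproof x) (hermitian_subproof x y) /=.
by congr (_ * _); apply/eqP; rewrite -subr_eq0 -form_subl h.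
Qed.

End Projection.

Section Reflectable.
Variables (V : lmodType rat) (form : {symmetric V}).
Implicit Types (R W : set V).

Definition is_reflectable_subspace R W :=
  exists (Pi : set (Vbar form)) (lift : Vbar form -> V),
    [/\ is_reflectable_base (@bar_form V form)
          (red_part (@bar V form @` R)) Pi,
        forall x, Pi x -> R (lift x) /\ bar form (lift x) = x
      & W = lin_span (lift @` Pi)].

Definition root_shifts R (a : V) : set V :=
  [set s | radical form s /\ R (a + s)].

Definition root_part R W : set V :=
  [set a | W a /\ root_shifts R a !=set0].

End Reflectable.

(* Isomorphism of root systems: a linear map, injective on the span of Phi,
   carrying Phi onto Psi and preserving the integers <a,b>.  Only its values
   on the span of Phi matter. *)
Definition root_iso (U V : lmodType rat)
    (formU : U -> U -> rat) (Phi : set U)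
    (formV : V -> V -> rat) (Psi : set V) : Prop :=
  exists f : {linear U -> V},
    [/\ set_inj (lin_span Phi) f, f @` Phi = Psi
      & forall a b, Phi a -> Phi b ->
          cartan formV (f a) (f b) = cartan formU a b].

(* R is of type Delta when its image in V / V^0 is isomorphic to Delta. *)
Definition has_type (V : lmodType rat) (form : {symmetric V})
    (R Delta : set V) : Prop :=
  root_iso (@bar_form V form) (@bar V form @` R) form Delta.

Definition sign (a : bool) : rat := (-1) ^+ a.

(* The standard systems live in functions I -> rat; all roots have finite
   support, and on such functions dot is the form making the eps i
   orthonormal.  (rat^o is rat seen as a vector space over itself.) *)
Section StandardSystems.
Variable I : choiceType.

Definition dot (x y : I -> rat^o) : rat :=
  \sum_(i \in [set: I]) (x i * y i : rat).

Definition eps (i : I) : I -> rat^o := fun j => (i == j)%:R.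

Definition rootA : set (I -> rat^o) :=
  [set x : I -> rat^o | exists i j, i != j /\ x = eps i - eps j].

Definition rootD : set (I -> rat^o) :=
  [set x : I -> rat^o | exists (i j : I) (a b : bool),
    i != j /\ x = sign a *: eps i + sign b *: eps j].

Definition rootB : set (I -> rat^o) :=
  [set x : I -> rat^o | exists (i : I) (a : bool), x = sign a *: eps i]
  `|` rootD.

Definition rootC : set (I -> rat^o) :=
  [set x : I -> rat^o |
     exists (i : I) (a : bool), x = sign a *: ((2 : rat) *: eps i)]
  `|` rootD.

Definition rootBC : set (I -> rat^o) := rootB `|` rootC.

End StandardSystems.

Arguments dot I x y : clear implicits.
Arguments rootA I x : clear implicits.
Arguments rootB I x : clear implicits.
Arguments rootC I x : clear implicits.
Arguments rootD I x : clear implicits.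
Arguments rootBC I x : clear implicits.

Definition half_vector n (a : 'I_n -> bool) : 'I_n -> rat^o :=
  fun i => sign (a i) / 2.

Definition rootE8 : set ('I_8 -> rat^o) :=
  rootD 'I_8 `|`
  [set x : 'I_8 -> rat^o |
     exists2 a : 'I_8 -> bool, ~~ odd (\sum_i a i)%N & x = half_vector a].

(* E_7 and E_6 are cut out of E_8 by x_7 = - x_8 and x_6 = x_7 = - x_8
   (coordinates are numbered from 0 below). *)
Definition rootE7 : set ('I_8 -> rat^o) :=
  [set x : 'I_8 -> rat^o | rootE8 x /\ x (inord 6) = - x (inord 7)].
Definition rootE6 : set ('I_8 -> rat^o) :=
  [set x : 'I_8 -> rat^o | rootE7 x /\ x (inord 5) = x (inord 6)].

Definition rootF4 : set ('I_4 -> rat^o) :=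
  rootB 'I_4 `|`
  [set x : 'I_4 -> rat^o | exists a : 'I_4 -> bool, x = half_vector a].

Definition rootG2 : set ('I_3 -> rat^o) :=
  rootA 'I_3 `|`
  [set x : 'I_3 -> rat^o |
     exists (i j k : 'I_3) (a : bool), uniq [:: i; j; k] /\
     x = sign a *: ((2 : rat) *: eps i - eps j - eps k)].

(* TypeA I has rank |I| - 1 for finite I; in the other infinite families I
   has the cardinality of the rank.  BC_1 is kept apart from TypeBC. *)
Inductive root_type :=
  | TypeA of choiceType | TypeB of choiceType | TypeC of choiceType
  | TypeD of choiceType | TypeE6 | TypeE7 | TypeE8
  | TypeBC of choiceType | TypeBC1 | TypeF4 | TypeG2.

Definition rank_condition (t : root_type) : Prop :=
  match t with
  | TypeA J | TypeB J | TypeC J | TypeBC J => `I_2 #<= [set: J]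
  | TypeD J => `I_4 #<= [set: J]
  | _ => True
  end.

Definition root_index (t : root_type) : choiceType :=
  match t with
  | TypeA J | TypeB J | TypeC J | TypeD J | TypeBC J => J
  | TypeE6 | TypeE7 | TypeE8 => 'I_8
  | TypeBC1 => 'I_1
  | TypeF4 => 'I_4
  | TypeG2 => 'I_3
  end.

Definition standard (t : root_type) : set (root_index t -> rat^o) :=
  match t return set (root_index t -> rat^o) with
  | TypeA J => rootA J
  | TypeB J => rootB J
  | TypeC J => rootC J
  | TypeD J => rootD J
  | TypeE6 => rootE6
  | TypeE7 => rootE7
  | TypeE8 => rootE8
  | TypeBC J => rootBC J
  | TypeBC1 => rootBC 'I_1
  | TypeF4 => rootF4
  | TypeG2 => rootG2
  end.

Arguments standard t x : clear implicits.

Section Description.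
Variables (V : lmodType rat) (form : V -> V -> rat).
Implicit Types (Delta S L E G : set V).

Definition is_of_type Delta (t : root_type) :=
  rank_condition t /\ root_iso form Delta (dot (root_index t)) (standard t).

(* L and E are constrained only when long, respectively extra long, roots
   exist. *)
Definition chain_condition Delta S L E :=
  [/\ S !=set0 /\ S `<=` radical form,
      long_roots form Delta !=set0 -> L !=set0 /\ L `<=` S
    & extra_long_roots form Delta !=set0 ->
        [/\ E !=set0, E `<=` S & long_roots form Delta !=set0 -> E `<=` L]].

Definition type_conditions (t : root_type) Delta S L E G : Prop :=
  let V0 := radical form in
  match t with
  | TypeA _ =>
      pointed_reflection_space V0 S /\
      (~ root_iso form Delta (dot 'I_2) (rootA 'I_2) -> S = G)
  | TypeB J =>
      [/\ pointed_reflection_space V0 S, pointed_reflection_space V0 L,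
          sumset (dilate 2 S) L `<=` L, sumset S L `<=` S
        & `I_3 #<= [set: J] -> subgroup L]
  | TypeC J =>
      [/\ pointed_reflection_space V0 S, pointed_reflection_space V0 L,
          sumset (dilate 2 S) L `<=` L, sumset S L `<=` S
        & `I_3 #<= [set: J] -> S = G]
  | TypeD _ | TypeE6 | TypeE7 | TypeE8 => S = G
  | TypeBC J =>
      [/\ [/\ pointed_reflection_space V0 S, pointed_reflection_space V0 L
            & reflection_space V0 E],
          sumset (dilate 2 S) L `<=` L /\ sumset S L `<=` S,
          sumset (dilate 4 S) E `<=` E /\ sumset S E `<=` S,
          sumset (dilate 2 L) E `<=` E /\ sumset L E `<=` L
        & `I_3 #<= [set: J] -> subgroup L]
  | TypeBC1 =>
      [/\ pointed_reflection_space V0 S, reflection_space V0 E,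
          sumset (dilate 4 S) E `<=` E & sumset S E `<=` S]
  | TypeF4 => [/\ S = G, subgroup L & dilate 2 G `<=` L]
  | TypeG2 => [/\ S = G, subgroup L & dilate 3 G `<=` L]
  end.

Definition type_pieces (t : root_type) Delta S L E G : seq (set V) :=
  let sh := short_roots form Delta in
  let lg := long_roots form Delta in
  let ex := extra_long_roots form Delta in
  match t with
  | TypeA _ => [:: sumset Delta S]
  | TypeB _ | TypeC _ => [:: sumset sh S; sumset lg L]
  | TypeD _ | TypeE6 | TypeE7 | TypeE8 => [:: sumset Delta G]
  | TypeBC _ => [:: sumset sh S; sumset lg L; sumset ex E]
  | TypeBC1 => [:: sumset sh S; sumset ex E]
  | TypeF4 | TypeG2 => [:: sumset sh G; sumset lg L]
  end.

End Description.

Definition union_of (T : Type) (P : seq (set T)) : set T :=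
  \bigcup_(i in `I_(size P)) nth set0 P i.

Definition pairwise_disjoint (T : Type) (P : seq (set T)) :=
  trivIset `I_(size P) (nth set0 P).

Definition is_BC (t : root_type) : bool :=
  match t with TypeBC _ | TypeBC1 => true | _ => false end.

(* Main.v *)
From HB Require Import structures.
Require Import Defs.
From mathcomp Require Import all_boot all_order all_algebra sesquilinear.
From mathcomp Require Import boolp classical_sets functions cardinality fsbigop.
From mathcomp Require Import ring lra zify.

Set Implicit Arguments.
Unset Strict Implicit.
Unset Printing Implicit Defensive.

Import Order.TTheory GRing.Theory Num.Theory.
Local Open Scope classical_set_scope.
Local Open Scope ring_scope.

(** Let a + s and b + t be elements of R with s, t in the radical V0. The
    reflection in a + s sends b + t to sigma_a(b) + (t - <b,a> s)
    ([reflection_mod_radical]). Hence the shifts of a LEARS satisfy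

      S_b - <b,a> S_a is contained in S_c, where c = sigma_a(b),

    and any family of subsets of V0 with this property yields a set closed
    under reflections. The theorem is the study of this one relation.

    From a LEARS to its shifts. The reflectable base provides a zero shift for
    every indivisible root ([indivisible_in_R]), so that S_b does not change
    when b is reflected ([shifts_invariant]). Roots of equal norm are
    conjugate ([equal_norm_ind]), hence S_a depends on the norm of a only.
    Relative to the minimal norm, the norms are 1, 4 (the extra long roots)
    and one of 2 and 3 ([long_norm], [long_norm_eq]): this gives S, E and L.
    Two roots of norm ratio k = 2 or 3 can be chosen with Cartan integers -1
    and -k ([obtuse_pair]), and the relation becomes, for instance, S + L in S
    and k S + L in L. Two roots of the same norm with Cartan integer -1 make
    their shifts closed under addition, hence a group. These consequences form
    the record [shift_system], proved in [shifts_system].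

    From shifts to a LEARS. Two roots of given norms have few possible Cartan
    integers, and a shift system covers all of them ([class_shift_closed]);
    [shifted_roots_lears] and [shifted_roots_type] conclude.

    Types. The conditions of each type say the same as [shift_system]
    ([system_type_conditions], [type_conditions_system]) once its [profile] is
    known: which norms occur, and whether there are pairs of short or of long
    roots with Cartan integer -1. For instance, two long roots of B_I can have
    such a Cartan integer if and only if I has at least three elements, and
    this is why L is a group for |I| > 2. An isomorphism of root systems rescales the form
    ([iso_similarity]), so profiles are computed on the standard coordinates
    ([profile_transfer], [standard_profile]). In type A, the absence of such
    pairs characterizes A1 ([rank_one_iso], [A1_not_obtuse]). *)

(** * Spans, subgroups and sumsets *)

Section Spans.
Variable V : lmodType rat.
Implicit Types (A B X H W : set V).

Lemma subspaceN W x : subspace W -> W x -> W (- x).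
Proof. by case=> _ _ WZ Wx; rewrite -scaleN1r; apply: WZ. Qed.

Lemma subspaceB W x y : subspace W -> W x -> W y -> W (x - y).
Proof.
by move=> sW Wx Wy; case: (sW) => _ WD _; apply: WD => //; exact: subspaceN.
Qed.

Lemma lin_span_subspace X : subspace (lin_span X).
Proof.
split=> [W [[]]//|x y Xx Xy W WX|k x Xx W WX].
  by case: (WX) => -[_ WD _] _; apply: WD; [apply: Xx|apply: Xy].
by case: (WX) => -[_ _ WZ] _; apply: WZ; apply: Xx.
Qed.

Lemma sub_lin_span X : X `<=` lin_span X.
Proof. exact: sub_gen_smallest. Qed.

Lemma lin_span_sub X W : subspace W -> X `<=` W -> lin_span X `<=` W.
Proof. exact: smallest_sub. Qed.

Lemma sumset_subspace A B :
  subspace A -> subspace B -> subspace (sumset A B).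
Proof.
move=> [A0 AD AZ] [B0 BD BZ]; split.
- by exists 0 => //; exists 0; rewrite ?addr0.
- move=> _ _ [a Aa [b Bb <-]] [a' Aa' [b' Bb' <-]].
  by exists (a + a'); [exact: AD|exists (b + b'); [exact: BD|rewrite addrACA]].
- move=> k _ [a Aa [b Bb <-]].
  by exists (k *: a); [exact: AZ|exists (k *: b); [exact: BZ|rewrite scalerDr]].
Qed.

(** B contains y and k x + y, hence k x lies in its span. *)
Lemma lin_span_affine A B k y : k != 0 -> B y ->
  (forall x, A x -> B (k *: x + y)) -> lin_span A `<=` lin_span B.
Proof.
move=> k0 By AB; have sB := lin_span_subspace B; apply: lin_span_sub => // x Ax.
have -> : x = k^-1 *: ((k *: x + y) - y) by rewrite addrK scalerA mulVf// scale1r.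
case: (sB) => _ _ BZ; apply: BZ; apply: (subspaceB sB); apply: sub_lin_span => //.
exact: AB.
Qed.

Lemma generated_subgroup X : subgroup (generated X).
Proof.
split=> [H [[]]//|x y Xx Xy H HX].
by case: (HX) => -[_ HB] _; apply: HB; [apply: Xx|apply: Xy].
Qed.

Lemma subgroupN H x : subgroup H -> H x -> H (- x).
Proof. by case=> H0 HB Hx; rewrite -sub0r; apply: HB. Qed.

Lemma subgroupD H x y : subgroup H -> H x -> H y -> H (x + y).
Proof.
move=> sH Hx Hy; rewrite -[y]opprK; case: (sH) => _; apply=> //.
exact: subgroupN.
Qed.

End Spans.

(** * Symmetric forms, Cartan numbers and reflections *)

Section SymmetricForm.
Variables (V : lmodType rat) (form : {symmetric V}).

Lemma formC x y : form x y = form y x.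
Proof. by rewrite (hermitian_subproof x) expr0 mul1r. Qed.

Lemma formDl x y z : form (x + y) z = form x z + form y z.
Proof. exact: linearDl. Qed.

Lemma formZl k x z : form (k *: x) z = k * form x z.
Proof. exact: linearZl_LR. Qed.

Lemma formNl x z : form (- x) z = - form x z.
Proof. exact: linearNl. Qed.

Lemma formDr x y z : form z (x + y) = form z x + form z y.
Proof. by rewrite formC formDl -!(formC z). Qed.

Lemma formZr k x z : form z (k *: x) = k * form z x.
Proof. by rewrite formC formZl -(formC z). Qed.

Lemma formNr x z : form z (- x) = - form z x.
Proof. by rewrite formC formNl -(formC z). Qed.

Definition formE := (formDl, formDr, formNl, formNr, formZl, formZr).

Lemma radical_subspace : subspace (radical form).
Proof.
split=> [y|x y rx ry z|k x rx z]; first by rewrite -(scale0r (0 : V)) formZl mul0r.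
  by rewrite formDl rx ry addr0.
by rewrite formZl rx mulr0.
Qed.

Lemma cartan_eq0 a b : form a b = 0 -> cartan form a b = 0.
Proof. by rewrite /cartan => ->; rewrite mulr0 mul0r. Qed.

Lemma cartanK a b : form b b != 0 -> cartan form a b * form b b = 2 * form a b.
Proof. by move=> b0; rewrite /cartan divfK. Qed.

Lemma cartanNl a b : cartan form (- a) b = - cartan form a b.
Proof. by rewrite /cartan formNl mulrN mulNr. Qed.

Lemma cartanNr a b : cartan form a (- b) = - cartan form a b.
Proof. by rewrite /cartan !formE opprK mulrN mulNr. Qed.

Lemma cartanZl k a b : cartan form (k *: a) b = k * cartan form a b.
Proof. by rewrite /cartan formZl; ring. Qed.

Lemma cartanDl a b c : cartan form (a + b) c = cartan form a c + cartan form b c.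
Proof. by rewrite /cartan formDl; ring. Qed.

Lemma form_reflection a x y :
  form (reflection form a x) (reflection form a y) = form x y.
Proof.
rewrite /reflection /cartan !formE; have [->|a0] := eqVneq (form a a) 0.
  by rewrite invr0; ring.
by rewrite (formC a y); field.
Qed.

Lemma reflectionK a : form a a != 0 -> involutive (reflection form a).
Proof.
move=> a0 x; rewrite {1}/reflection.
have -> : cartan form (reflection form a x) a = - cartan form x a.
  by rewrite /reflection /cartan !formE; field.
by rewrite /reflection scaleNr opprK subrK.
Qed.

Lemma reflection_self a : form a a != 0 -> reflection form a a = - a.
Proof.
move=> a0; rewrite /reflection.
have -> : cartan form a a = 2 by rewrite /cartan mulfK.
by rewrite -{1}[a]scale1r -scalerBl -scaleN1r; congr (_ *: _); ring.
Qed.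

Lemma reflectionN a x : reflection form (- a) x = reflection form a x.
Proof. by rewrite /reflection cartanNr scalerN scaleNr opprK. Qed.

End SymmetricForm.

Lemma signE (s : bool) : sign s = if s then -1 else 1.
Proof. by case: s. Qed.

(** The pairs of Cartan integers of two non-orthogonal vectors, the first one
    being the smaller in absolute value. *)
Lemma int_product_le4 (n m : rat) : n \is a Num.int -> m \is a Num.int ->
  0 < n * m <= 4 -> n ^+ 2 <= m ^+ 2 -> exists s : bool,
  (n = sign s /\ (m = sign s * 1 \/ m = sign s * 2 \/ m = sign s * 3 \/ m = sign
    s * 4)) \/
  (n = sign s * 2 /\ m = sign s * 2).
Proof.
move=> /intrP[N ->] /intrP[M ->]; rewrite -!rmorphM -!rmorphXn /= -[4%R]/(4%:~R).
rewrite -[0]/(0%:~R) ltr_int !ler_int => /andP[h1 h2] h3.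
have hN : N = -2 \/ N = -1 \/ N = 1 \/ N = 2 by nia.
have hM : -4 <= M <= 4 by nia.
have hM' : M = -4 \/ M = -3 \/ M = -2 \/ M = -1 \/ M = 0 \/ M = 1 \/ M = 2 \/
    M = 3 \/ M = 4 by lia.
by case: hN => [|[|[|]]] ?; subst N;
  case: hM' => [|[|[|[|[|[|[|[|]]]]]]]] ?; subst M; (try by lia);
  do ?[by exists true; intuition | by exists false; intuition].
Qed.

(** * Positive definite irreducible root systems *)

Section RootTheory.
Variables (V : lmodType rat) (form : {symmetric V}) (W Delta : set V).
Hypothesis rsys : is_lf_irr_root_system form W Delta.

Lemma root_in_span a : Delta a -> W a.
Proof. by case: rsys => [[_ _ _ _ <- *]] Da; apply: sub_lin_span. Qed.

Lemma root_span_subspace : subspace W.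
Proof. by case: rsys => -[]. Qed.

Lemma root_norm_gt0 a : Delta a -> 0 < form a a.
Proof.
move=> Da; case: (rsys) => -[_ _ _ an _ _ _ _]; apply; first exact: root_in_span.
by apply: contra_neq (an _ Da) => ->; rewrite -(scale0r (0 : V)) formZl mul0r.
Qed.

Lemma root_norm_neq0 a : Delta a -> form a a != 0.
Proof. by move/root_norm_gt0/lt0r_neq0. Qed.

Lemma root_int a b : Delta a -> Delta b -> cartan form a b \is a Num.int.
Proof. by case: rsys => -[? ? ? ? ? h _ _] _; apply: h. Qed.

Lemma root_reflection a b : Delta a -> Delta b -> Delta (reflection form a b).
Proof. by case: rsys => -[? ? ? ? ? _ h _] _; apply: h. Qed.

Lemma root_opp a : Delta a -> Delta (- a).
Proof.
move=> Da; rewrite -(reflection_self (root_norm_neq0 Da)).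
exact: root_reflection.
Qed.

Lemma root_irreducible R1 R2 : Delta = R1 `|` R2 ->
  (forall a b, R1 a -> R2 b -> form a b = 0) -> R1 = set0 \/ R2 = set0.
Proof. by case: rsys => -[? ? ? ? ? _ _ h] _; apply: h. Qed.

(** The norm of a - (a,b)/(b,b) b, the part of a orthogonal to b, is
    nonnegative, and zero only if a is proportional to b. *)
Lemma root_cauchy a b : Delta a -> Delta b ->
  form a b ^+ 2 <= form a a * form b b /\
  (form a b ^+ 2 = form a a * form b b -> a = (form a b / form b b) *: b).
Proof.
move=> Da Db; have b0 := root_norm_gt0 Db.
set x := a - (form a b / form b b) *: b.
have Wx : W x.
  apply: subspaceB root_span_subspace (root_in_span Da) _.
  by case: root_span_subspace => _ _; apply; apply: root_in_span.
have xx : form x x = (form a a * form b b - form a b ^+ 2) / form b b.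
  by rewrite /x !formE (formC form b a); field; apply: lt0r_neq0.
split=> [|eqab].
  have : 0 <= form x x by case: rsys => -[_ psd *]; apply: psd.
  by rewrite xx pmulr_lge0 ?invr_gt0// subr_ge0.
apply/eqP; rewrite -subr_eq0 -/x; apply/eqP; apply: contrapT => /eqP x0.
by case: rsys => _ /(_ x Wx x0); rewrite xx eqab subrr mul0r ltxx.
Qed.

(** The product of the Cartan integers of a and b is 4 cos^2 of their angle,
    an integer from 1 to 4. The value 4 is equality in the Cauchy-Schwarz
    inequality, where a and b are proportional; otherwise the smaller of the
    two integers is a sign and the other one is the norm ratio up to that
    sign. *)
Lemma nonorthogonal_roots a b : Delta a -> Delta b -> form a b != 0 ->
  form a a <= form b b ->
  exists s : bool, [\/ b = sign s *: a, b = (sign s * 2) *: a |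
    exists j : rat, (j = 1 \/ j = 2 \/ j = 3) /\
      [/\ cartan form a b = sign s, cartan form b a = sign s * j
        & form b b = j * form a a]].
Proof.
move=> Da Db ab0 leab.
have a0 := root_norm_gt0 Da; have b0 := root_norm_gt0 Db.
have [cs cs_eq] := root_cauchy Db Da.
have na := cartanK b (root_norm_neq0 Da).
have nb := cartanK a (root_norm_neq0 Db).
have ia := root_int Db Da; have ib := root_int Da Db.
have ba : form b a = form a b := formC form b a.
have ab2 : 0 < form a b ^+ 2 by rewrite exprn_even_gt0.
move: (cartan form a b) (cartan form b a) => n m in na nb ia ib *.
rewrite ba in na cs cs_eq.
have nm : n * m * (form a a * form b b) = 4 * form a b ^+ 2.
  have -> : n * m * (form a a * form b b) = (m * form a a) * (n * form b b) by ring.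
  by rewrite na nb; ring.
have ab_gt0 : 0 < form a a * form b b by rewrite mulr_gt0.
have nm_lim : 0 < n * m <= 4.
  rewrite -(pmulr_lgt0 _ ab_gt0) nm; apply/andP; split; first by lra.
  by rewrite -(ler_pM2r ab_gt0) nm ler_pM2l // [form a a * _]mulrC.
have nm2 : n ^+ 2 <= m ^+ 2.
  have e : (n * form b b) ^+ 2 = (m * form a a) ^+ 2 by rewrite na nb.
  rewrite -(ler_pM2r (exprn_gt0 2 a0)) -!exprMn -e !exprMn.
  by rewrite ler_wpM2l ?sqr_ge0// lerXn2r// nnegrE ltW.
have prop : n * m = 4 -> b = (m / 2) *: a.
  move=> nm4; rewrite {1}cs_eq; last first.
    by apply: (mulfI (_ : 4 != 0 :> rat)) => //;
      rewrite -nm nm4 [form b b * _]mulrC.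
  by congr (_ *: _); apply: (mulIf (lt0r_neq0 a0)); rewrite divfK ?lt0r_neq0//; lra.
have len : n * form b b = m * form a a by lra.
have [s [[n1 mj]|[n2 m2]]] := int_product_le4 ib ia nm_lim nm2; exists s;
  last first.
  apply: Or31; rewrite prop ?n2 ?m2.
    by congr (_ *: _); rewrite mulfK.
  by rewrite !signE; case: (s); ring.
have ss : sign s * sign s = 1 by rewrite !signE; case: (s); ring.
case: mj => [|[|[|]]] mj; [apply: Or33; exists 1|apply: Or33; exists 2|
  apply: Or33; exists 3|apply: Or32].
- split; first by left.
  split=> //; move: len; rewrite n1 mj signE; case: (s) => /=; lra.
- split; first by right; left.
  split=> //; move: len; rewrite n1 mj signE; case: (s) => /=; lra.
- split; first by right; right.
  split=> //; move: len; rewrite n1 mj signE; case: (s) => /=; lra.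
rewrite prop mj; first by congr (_ *: _); lra.
by rewrite n1 mulrA ss mul1r.
Qed.

(** Let c be orthogonal to all roots satisfying P, and a' be such a root with
    (a',b) <> 0. If (b,c) were nonzero, the reflection of a' in b would
    satisfy P without being orthogonal to c. So the roots that P meets are
    orthogonal to the roots that it does not meet, and irreducibility leaves
    no room for the latter. *)
Lemma invariant_meets (P : V -> Prop) a :
  (forall c d, Delta c -> Delta d -> P d -> P (reflection form c d)) ->
  Delta a -> P a ->
  forall b, Delta b -> exists a', [/\ Delta a', P a' & form a' b != 0].
Proof.
move=> Pinv Da Pa.
pose M b := exists a', [/\ Delta a', P a' & form a' b != 0].
suff : [set b | Delta b /\ ~ M b] = set0.
  by move=> M0 b Db; apply: contrapT => nMb; rewrite -[False]/(set0 b) -M0.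
have [||M0|//] := @root_irreducible [set b | Delta b /\ M b]
    [set b | Delta b /\ ~ M b].
- by apply/seteqP; split=> [b Db|b [[]|[]]//]; case: (pselect (M b)); [left|right].
- move=> b c [Db [a' [Da' Pa' a'b]]] [Dc nMc]; apply: contrapT => /eqP bc0;
  apply: nMc.
  have [a'c|a'c] := eqVneq (form a' c) 0; last by exists a'.
  exists (reflection form b a'); split; [exact: root_reflection|exact: Pinv|].
  rewrite /reflection /cartan !formE a'c add0r -mulNr mulf_neq0//.
  by rewrite oppr_eq0 mulf_neq0 ?invr_eq0 ?root_norm_neq0// mulf_neq0.
- have : set0 a by rewrite -M0; split=> //; exists a; split=> //;
  exact: root_norm_neq0.
  by [].
Qed.

(** Conjugacy of roots of equal norm under the Weyl group, as an induction
    principle. By [invariant_meets] b may be compared with a root a' which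
    satisfies P, has the norm of b and is not orthogonal to it: either
    b = a' or b = - a', or the two span a system A2, in which two reflections
    carry a' to b up to sign. *)
Lemma equal_norm_ind (P : V -> Prop) a b :
  (forall c d, Delta c -> Delta d -> P d -> P (reflection form c d)) ->
  Delta a -> Delta b -> form a a = form b b -> P a -> P b.
Proof.
move=> Pinv Da Db eqab Pa.
pose Q c := P c /\ form c c = form a a.
have Qinv c d : Delta c -> Delta d -> Q d -> Q (reflection form c d).
  by move=> Dc Dd [Pd dd]; split; [exact: Pinv|rewrite form_reflection].
have [a' [Da' [Pa' a'a] a'b]] := invariant_meets Qinv Da (conj Pa erefl) Db.
have a'0 := root_norm_neq0 Da'.
have Pna' : P (- a') by rewrite -(reflection_self a'0); apply: (Pinv).
have le : form a' a' <= form b b by rewrite a'a eqab.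
have [s [->|b2|[j [_ [c1 c2 bb]]]]] := nonorthogonal_roots Da' Db a'b le.
- by rewrite signE; case: s; rewrite ?scaleN1r ?scale1r.
- move: eqab; rewrite -a'a {1 2}b2 !formE signE => /eqP.
  have := root_norm_gt0 Da'; case: (s) => /=; lra.
have j1 : j = 1.
  by apply: (mulIf a'0); rewrite -bb mul1r a'a eqab.
rewrite j1 mulr1 in c2.
have sb : reflection form a' (reflection form b a') = - (sign s *: b).
  rewrite {2}/reflection c1 /reflection cartanDl cartanNl cartanZl.
  have -> : cartan form a' a' = 2 by rewrite /cartan mulfK.
  rewrite c2; have -> : 2 - sign s * sign s = 1 :> rat by rewrite signE;
    case: (s) => /=; ring.
  by rewrite scale1r addrAC subrr add0r.
have P1 : P (- (sign s *: b)).
  by rewrite -sb; apply: (Pinv) => //; [exact: root_reflection|exact: Pinv].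
have P2 : P (sign s *: b).
  have -> : sign s *: b = reflection form b (- (sign s *: b)).
    rewrite /reflection cartanNl cartanZl /cartan mulfK ?root_norm_neq0//.
    by rewrite -scaleNr -scalerBl; congr (_ *: _); ring.
  apply: (Pinv) => //; rewrite signE; case: (s);
    rewrite ?scaleN1r ?opprK ?scale1r//.
  exact: root_opp.
by move: P1 P2; rewrite signE; case: (s); rewrite ?scaleN1r ?opprK ?scale1r.
Qed.

Lemma equal_norm_meets a b : Delta a -> Delta b ->
  exists a', [/\ Delta a', form a' a' = form a a & form a' b != 0].
Proof.
move=> Da; apply: (@invariant_meets (fun c => form c c = form a a) a) => //.
by move=> c d _ _; rewrite form_reflection.
Qed.

(** Replacing a by a conjugate that is not orthogonal to b does not change
    its norm. *)
Lemma norm_ratio a b : Delta a -> Delta b -> form a a <= form b b ->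
  exists j : rat, (j = 1 \/ j = 2 \/ j = 3 \/ j = 4) /\ form b b = j * form a a.
Proof.
move=> Da Db leab; have [a' [Da' a'a a'b]] := equal_norm_meets Da Db.
rewrite -a'a in leab *.
have [s [->|->|[j [hj [_ _ ->]]]]] := nonorthogonal_roots Da' Db a'b leab.
- by exists 1; split; [left|rewrite !formE signE; case: (s) => /=; ring].
- by exists 4; split; [do 3 right|rewrite !formE signE; case: (s) => /=; ring].
by exists j; split=> //; case: hj => [|[|]]; intuition.
Qed.

(** Norm ratios lie in the finite set 1/4, 1/3, 1/2, 1, 2, 3, 4, so a
    minimal norm exists: 12 times the ratio is a natural number. *)
Lemma short_root_exists : exists a, short_roots form Delta a.
Proof.
case: (rsys) => -[_ _ [a Da] _ _ _ _ _] _.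
pose P (n : nat) := `[< exists b, Delta b /\ 12 * form b b = n%:R * form a a >].
have a0 := root_norm_gt0 Da.
have Pex b : Delta b -> exists n : nat, 12 * form b b = n%:R * form a a.
  move=> Db; case: (leP (form a a) (form b b)) => [le|/ltW le].
    by have [j [[->|[->|[->|->]]] ->]] := norm_ratio Da Db le;
      [exists 12%N|exists 24%N|exists 36%N|exists 48%N]; ring.
  have [j [jE e]] := norm_ratio Db Da le.
  case: jE e => [->|[->|[->|->]]] ->;
    [exists 12%N|exists 6%N|exists 4%N|exists 3%N]; ring.
have P12 : exists n, P n by exists 12%N; apply/asboolP; exists a.
case: (ex_minnP P12) => n /asboolP[b [Db eb]] nmin.
exists b; split=> // c Dc; have [m em] := Pex c Dc.
have nm : (n <= m)%N by apply: nmin; apply/asboolP; exists c.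
suff : 12 * form b b <= 12 * form c c by lra.
by rewrite eb em ler_pM2r// ler_nat.
Qed.

Local Notation sh := (short_roots form Delta).
Local Notation lg := (long_roots form Delta).
Local Notation ex := (extra_long_roots form Delta).

Lemma short_root a : sh a -> Delta a. Proof. by case. Qed.
Lemma extra_root a : ex a -> Delta a. Proof. by case. Qed.
Lemma long_root a : lg a -> Delta a. Proof. by case. Qed.

Lemma short_norm a b : sh a -> sh b -> form a a = form b b.
Proof. by move=> [Da ha] [Db hb]; apply/eqP; rewrite eq_le ha// hb. Qed.

Lemma short_normE a b : sh a -> Delta b -> form a a = form b b -> sh b.
Proof. by move=> [Da ha] Db e; split=> // c Dc; rewrite -e ha. Qed.

Lemma extra_norm a b : sh a -> ex b -> form b b = 4 * form a a.
Proof.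
move=> sa [Db [c sc ->]]; rewrite (short_norm sa sc) !formE; ring.
Qed.

Lemma extra_normE a b : sh a -> Delta b -> form b b = 4 * form a a -> ex b.
Proof.
move=> sa Db bb; have [Da amin] := sa; split=> //.
have [a' [Da' a'a a'b]] := equal_norm_meets Da Db.
have a0 := root_norm_gt0 Da'; have := amin _ Db; rewrite -a'a in bb * => le.
have sa' : sh a' by apply: short_normE sa Da' _.
have [s [e|e|[j [hj [_ _ e]]]]] := nonorthogonal_roots Da' Db a'b le.
- by move: bb; rewrite e !formE signE; case: (s) => /=; lra.
- exists (sign s *: a'); last by rewrite e scalerA mulrC.
  rewrite signE; case: (s); rewrite ?scale1r// scaleN1r.
  apply: short_normE sa' (root_opp Da') _; by rewrite !formE opprK.
by move: bb; rewrite e; case: hj => [->|[->|->]]; lra.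
Qed.

Lemma root_class a : Delta a -> [\/ sh a, lg a | ex a].
Proof.
move=> Da; case: (pselect (sh a)) => [|nsh]; first exact: Or31.
by case: (pselect (ex a)) => [|nex]; [exact: Or33|apply: Or32; split=> //; case].
Qed.

Lemma class_disjoint a : [/\ ~ (sh a /\ lg a), ~ (sh a /\ ex a) & ~ (lg a /\ ex a)].
Proof.
split=> [[sa [_]]|[sa exa]|[[_ h] exa]]; [by apply; left| |by apply: h; right].
have := extra_norm sa exa; have := root_norm_gt0 (short_root sa); lra.
Qed.

Lemma long_norm a b : sh a -> lg b -> form b b = 2 * form a a \/ form b b = 3 *
  form a a.
Proof.
move=> sa lb; have [Db nb] := lb; have [Da amin] := sa.
have [j [[->|[->|[->|->]]] e]] := norm_ratio Da Db (amin _ Db);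
  [|by left|by right|].
  by case: nb; left; apply: short_normE sa Db _; rewrite e mul1r.
by case: nb; right; apply: extra_normE sa Db e.
Qed.

(** Norms 2 and 3 times the minimal one exclude each other, because 3/2 is
    not a norm ratio. *)
Lemma long_norm_eq b c : lg b -> lg c -> form b b = form c c.
Proof.
wlog le : b c / form b b <= form c c.
  by move=> h lb lc; case/orP: (le_total (form b b) (form c c)) => le;
    [|symmetry]; exact: h.
move=> lb lc; have [a sa] := short_root_exists.
have a0 := root_norm_gt0 (short_root sa).
have [j [hj e]] := norm_ratio (long_root lb) (long_root lc) le.
case: (long_norm sa lb) => eb; case: (long_norm sa lc) => ec; rewrite ?eb ?ec//;
  move: e; rewrite eb ec; case: hj => [->|[->|[->|->]]]; lra.
Qed.

(** Here the norm ratio excluded is 4/3. *)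
Lemma long_extra_norm a b c : sh a -> lg b -> ex c -> form b b = 2 * form a a.
Proof.
move=> sa lb xc; case: (long_norm sa lb) => // eb.
have ec := extra_norm sa xc; have a0 := root_norm_gt0 (short_root sa).
have le : form b b <= form c c by rewrite eb ec; lra.
have [j [hj e]] := norm_ratio (long_root lb) (extra_root xc) le.
by move: e; rewrite eb ec; case: hj => [->|[->|[->|->]]]; lra.
Qed.

Lemma long_extra_ratio b c : lg b -> ex c -> form c c = 2 * form b b.
Proof.
move=> lb xc; have [a sa] := short_root_exists.
rewrite (long_extra_norm sa lb xc) (extra_norm sa xc); ring.
Qed.

Lemma long_normE b c : lg b -> Delta c -> form b b = form c c -> lg c.
Proof.
move=> lb Dc e; have [a sa] := short_root_exists.
have [sc|//|xc] := root_class Dc.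
  have := short_norm sa sc; have := root_norm_gt0 (short_root sa).
  by case: (long_norm sa lb) => ?; lra.
have := extra_norm sa xc; have := root_norm_gt0 (short_root sa).
by case: (long_norm sa lb) => ?; lra.
Qed.

Lemma class_reflection a b : Delta a -> Delta b ->
  [/\ sh b -> sh (reflection form a b), lg b -> lg (reflection form a b)
    & ex b -> ex (reflection form a b)].
Proof.
move=> Da Db; have Dr := root_reflection Da Db.
have e : form (reflection form a b) (reflection form a b) = form b b
  by rewrite form_reflection.
have [c sc] := short_root_exists.
split=> h; [exact: (short_normE h Dr (esym e))|exact: (long_normE h Dr (esym e))|].
by apply: (extra_normE sc) => //; rewrite e (extra_norm sc h).
Qed.

(** Being half of a root is invariant under reflections. *)
Lemma extra_double a : ex !=set0 -> sh a -> Delta (2 *: a).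
Proof.
move=> [x [Db [b sb eb]]] sa; rewrite eb in Db.
apply: (@equal_norm_ind (fun c => Delta (2 *: c)) b) (short_norm sb sa) Db;
  [|exact: short_root|exact: short_root].
move=> c d Dc Dd D2; have := root_reflection Dc D2.
by rewrite /reflection cartanZl scalerBr scalerA.
Qed.

(** Moving a by reflections makes it non-orthogonal to b; a change of sign
    then makes the angle obtuse. *)
Lemma obtuse_pair a b j : Delta a -> Delta b -> 1 < j < 4 ->
  form b b = j * form a a ->
  exists a', [/\ Delta a', form a' a' = form a a, cartan form a' b = -1
                & cartan form b a' = - j].
Proof.
move=> Da Db /andP[j1 j4] e; have [a' [Da' a'a a'b]] := equal_norm_meets Da Db.
have a0 := root_norm_gt0 Da'; rewrite -a'a in e *.
have le : form a' a' <= form b b by rewrite e; nra.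
have [s [eb|eb|[i [hi [c1 c2 eb]]]]] := nonorthogonal_roots Da' Db a'b le.
- move: e; rewrite eb !formE signE; case: (s) => /=; nra.
- move: e; rewrite eb !formE signE; case: (s) => /=; nra.
have ij : i = j by apply: (mulIf (lt0r_neq0 a0)); rewrite -eb.
rewrite ij in c2; move: c1 c2; rewrite signE; case: (s) => c1 c2.
  by exists a'; split=> //; rewrite c2; ring.
exists (- a'); split; first exact: root_opp.
- by rewrite !formE opprK.
- by rewrite cartanNl c1.
- by rewrite cartanNr c2; ring.
Qed.

(** For a class of roots of one norm, two roots at an angle of 120 degrees. *)
Definition has_obtuse_pair (C : set V) :=
  exists a b, [/\ C a, C b & cartan form a b = -1].

(** If 2 b is a root, the Cartan number of a and b is twice that of a and
    2 b, hence even. *)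
Lemma extra_no_obtuse_short : ex !=set0 -> ~ has_obtuse_pair sh.
Proof.
move=> xn [a [b [sa sb ab]]].
have := root_int (short_root sa) (extra_double xn sb).
have -> : cartan form a (2 *: b) = - (1 / 2).
  move: ab; rewrite /cartan !formE => ab.
  have b0 := root_norm_neq0 (short_root sb).
  suff -> : 2 * (2 * form a b) / (2 * (2 * form b b)) = (2 * form a b / form b b)
    / 2.
    by rewrite ab; ring.
  by field.
by [].
Qed.

Lemma extra_no_obtuse_extra : ~ has_obtuse_pair ex.
Proof.
move=> [x [y [[Da [a sa ea]] [Db [b sb eb]] ab]]]; rewrite {}ea {}eb in Da Db ab.
have xn : ex !=set0 by exists (2 *: b); split=> //; exists b.
apply: (extra_no_obtuse_short xn); exists a, b; split=> //.
rewrite -ab /cartan !formE; field; exact: root_norm_neq0 (short_root sb).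
Qed.

(** Two roots of one norm are orthogonal, equal up to sign, or at an angle of
    60 or 120 degrees; a sign exchanges the last two cases. *)
Lemma equal_norm_cartan (C : set V) a b : C `<=` Delta ->
  (forall a, C a -> C (- a)) -> C a -> C b -> form a a = form b b ->
  [\/ cartan form b a = 0, cartan form b a = 2 /\ a = b,
    cartan form b a = -2 /\ a = - b
    | has_obtuse_pair C /\ (cartan form b a = 1 \/ cartan form b a = -1)].
Proof.
move=> CD CN Ca Cb e; have [Da Db] := (CD _ Ca, CD _ Cb).
have a0 := root_norm_gt0 Da; have a00 := root_norm_neq0 Da.
have [ab|ab] := eqVneq (form a b) 0.
  by apply: Or41; apply: cartan_eq0; rewrite formC.
have le : form a a <= form b b by rewrite e.
have [s [eb|eb|[i [hi [c1 c2 eb]]]]] := nonorthogonal_roots Da Db ab le.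
- move: eb; rewrite signE; case: (s) => eb; [apply: Or43|apply: Or42]; rewrite eb.
    by rewrite scaleN1r opprK cartanNl /cartan mulfK.
  by rewrite scale1r /cartan mulfK.
- by move: e; rewrite eb !formE signE; case: (s) => /=; lra.
have i1 : i = 1 by apply: (mulIf a00); rewrite -eb mul1r.
apply: Or44; rewrite i1 mulr1 in c2; move: c1 c2; rewrite signE.
case: (s) => c1 c2; (split; last by intuition).
  by exists a, b.
by exists (- a), b; split=> //; [exact: CN|rewrite cartanNl c1].
Qed.

End RootTheory.

(** * The radical and the quotient by the radical *)

(** Indexing the combination by the points of P, and not by their images, is
    what lets the linear independence of a subset of V / V0 apply to a
    combination of preimages. *)
Lemma lin_span_image (T : choiceType) (V : lmodType rat) (g : T -> V) (P : set T) x :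
  lin_span (g @` P) x -> exists (s : seq T) (c : T -> rat),
    [/\ uniq s, forall y, y \in s -> P y & x = \sum_(y <- s) c y *: g y].
Proof.
pose K := [set x | exists (s : seq T) (c : T -> rat),
    [/\ uniq s, forall y, y \in s -> P y & x = \sum_(y <- s) c y *: g y]].
apply: (@lin_span_sub _ _ K) => [|_ [y Py <-]]; last first.
  exists [:: y], (fun=> 1); split=> // [z|]; first by rewrite inE => /eqP ->.
  by rewrite big_seq1 scale1r.
split=> [|_ _ [s1 [c1 [u1 P1 ->]]] [s2 [c2 [u2 P2 ->]]]|k _ [s [c [us Ps ->]]]].
- by exists [::], (fun=> 0); rewrite big_nil.
- pose s := undup (s1 ++ s2).
  exists s, (fun y => (if y \in s1 then c1 y else 0) + (if y \in s2 then c2 y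
    else 0)).
  have sumE s' c' : uniq s' -> {subset s' <= s} ->
      \sum_(y <- s) (if y \in s' then c' y else 0) *: g y = \sum_(y <- s') c' y
        *: g y.
    move=> us' sub; rewrite (eq_bigr (fun y => if y \in s' then c' y *: g y else
      0)).
      rewrite -big_mkcond -big_filter; apply: perm_big; apply: uniq_perm => //.
        by rewrite filter_uniq ?undup_uniq.
      by move=> y; rewrite mem_filter; case: (boolP (y \in s')) => //= /sub.
    by move=> y _; case: ifP => // _; rewrite scale0r.
  split; first exact: undup_uniq.
    by move=> y; rewrite mem_undup mem_cat => /orP[/P1|/P2].
  under [RHS]eq_bigr do rewrite scalerDl.
  by rewrite big_split /= !sumE// => y ys; rewrite mem_undup mem_cat ys ?orbT.
- exists s, (fun y => k * c y); split=> //.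
  by rewrite scaler_sumr; apply: eq_bigr => y _; rewrite scalerA.
Qed.

Section Semidefinite.
Variables (V : lmodType rat) (form : {symmetric V}).
Local Notation V0 := (radical form).

Lemma radicalC x y : V0 x -> form y x = 0.
Proof. by move=> rx; rewrite formC rx. Qed.

Lemma radical0 : V0 0.
Proof. by case: (radical_subspace form). Qed.

Lemma radicalZ k x : V0 x -> V0 (k *: x).
Proof. by case: (radical_subspace form) => _ _ Z; exact: Z. Qed.

Lemma radicalB x y : V0 x -> V0 y -> V0 (x - y).
Proof. exact: subspaceB (radical_subspace form). Qed.

Lemma form_mod_radical x y r t : V0 r -> V0 t -> form (x + r) (y + t) = form x y.
Proof. by move=> hr ht; rewrite !formE hr (radicalC _ ht) (hr t) !addr0. Qed.

Lemma cartan_mod_radical x y r t : V0 r -> V0 t ->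
  cartan form (x + r) (y + t) = cartan form x y.
Proof. by move=> hr ht; rewrite /cartan !form_mod_radical. Qed.

(** The identity behind all relations between shifts. *)
Lemma reflection_mod_radical a b s t : V0 s -> V0 t ->
  reflection form (a + s) (b + t)
    = reflection form a b + (t - cartan form b a *: s).
Proof.
move=> hs ht; rewrite /reflection cartan_mod_radical// scalerDr opprD addrACA.
by [].
Qed.

(** A semidefinite form takes both signs along a line y + t x as soon as x
    is isotropic and not orthogonal to y. *)
Lemma isotropic_radical : (forall x, 0 <= form x x) ->
  forall x, form x x = 0 -> V0 x.
Proof.
move=> psd x xx y; apply: contrapT => /eqP xy0.
have := psd (y + (- (form y y + 1) / (2 * form x y)) *: x).
rewrite !formE xx (formC form y x).
have -> : (form y y + - (form y y + 1) / (2 * form x y) * form x y +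
  (- (form y y + 1) / (2 * form x y) * form x y +
   - (form y y + 1) / (2 * form x y) * (- (form y y + 1) / (2 * form x y) * 0)))
     = -1.
  by field.
by [].
Qed.

Section DirectSum.
Variable W : set V.
Hypotheses (sW : subspace W) (dW : direct_sum W V0).

Lemma direct_sum_ex x : exists v r, [/\ W v, V0 r & x = v + r].
Proof.
have [dWT _] := dW; have : [set: V] x by [].
by rewrite -dWT => -[v Wv [r Vr <-]]; exists v, r.
Qed.

Lemma direct_sum_inj v w r t : W v -> W w -> V0 r -> V0 t -> v + r = w + t ->
  v = w /\ r = t.
Proof.
move=> Wv Ww Vr Vt e; suff vw : v = w by split=> //; move: e; rewrite vw => /addrI.
apply/eqP; rewrite -subr_eq0; apply/eqP.
rewrite -[_ = 0]/([set 0] (v - w)); have [_ <-] := dW; split;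
  first exact: subspaceB.
have -> : v - w = t - r by rewrite -[v](addrK r) e addrAC [w + t]addrC addrK.
exact: radicalB.
Qed.

End DirectSum.
End Semidefinite.

Section BarTheory.
Variables (V : lmodType rat) (form : {symmetric V}).
Local Notation barf := (@bar V form).

Lemma barZ k x : barf (k *: x) = k *: barf x.
Proof. by rewrite -scale_barE. Qed.

Lemma bar_eq0 x : barf x = 0 <-> radical form x.
Proof.
have -> : 0 = barf 0 by rewrite /bar raddf0.
by split=> [/bar_eq|h]; [|apply/bar_eq]; rewrite subr0.
Qed.

Lemma barB x y : barf (x - y) = barf x - barf y.
Proof. by rewrite barD -scaleN1r barZ scaleN1r. Qed.

Lemma bar_sum (I : Type) (s : seq I) (c : I -> rat) (g : I -> V) :
  barf (\sum_(i <- s) c i *: g i) = \sum_(i <- s) c i *: barf (g i).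
Proof. by rewrite /bar raddf_sum; apply: eq_bigr => i _; exact: barZ. Qed.

Lemma bar_cartan x y : cartan (@bar_form V form) (barf x) (barf y) = cartan form
  x y.
Proof. by rewrite /cartan !bar_formE. Qed.

Lemma bar_reflection x y :
  reflection (@bar_form V form) (barf x) (barf y) = barf (reflection form x y).
Proof. by rewrite /reflection bar_cartan barB barZ. Qed.

Lemma bar_surj (x : Vbar form) : exists y, barf y = x.
Proof. by exists (repr x); exact: bar_repr. Qed.

End BarTheory.

(** * Reflectable subspaces *)

Section Decomposition.
Variables (V : lmodType rat) (form : {symmetric V}) (R W : set V).
Hypothesis RL : is_lears form [set: V] R.
Local Notation V0 := (radical form).
Local Notation Delta := (root_part form R W).
Local Notation barf := (@bar V form).

(** Delta is the projection of R to W along the radical, and this projection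
    preserves the form. The form is definite on W because isotropic vectors
    of a semidefinite form are radical. *)
Lemma root_part_system : subspace W -> direct_sum W V0 ->
  is_lf_irr_root_system form W Delta.
Proof.
move=> sW dW; case: (RL) => _ psd [x0 Rx0] an sp int refl irr.
have ex_part x : R x -> exists a s, [/\ Delta a, V0 s & x = a + s].
  move=> Rx; have [v [r [Wv Vr e]]] := direct_sum_ex dW x.
  by exists v, r; split=> //; split=> //; exists r; split=> //; rewrite -e.
have DW a : Delta a -> W a by case.
split; last first.
  move=> x Wx x0'; rewrite lt0r psd// andbT; apply: contra_neq x0' => xx.
  have : (W `&` V0) x by split=> //; apply: isotropic_radical xx => y; apply: psd.
  by case: dW => _ ->.
split.
- exact: sW.
- by move=> x _; exact: psd.
- by have [a [s [Da _ _]]] := ex_part _ Rx0; exists a.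
- by move=> a [Wa [s [Vs /an]]]; rewrite form_mod_radical.
- apply/seteqP; split=> [|x Wx]; first exact: lin_span_sub.
  have sub : lin_span R `<=` sumset (lin_span Delta) V0.
    apply: lin_span_sub => [|y /ex_part[a [s [Da Vs ->]]]].
      exact: sumset_subspace (lin_span_subspace _) (radical_subspace form).
    by exists a; [exact: sub_lin_span|exists s].
  have [d Dd [r Vr xE]] : sumset (lin_span Delta) V0 x by apply: sub; rewrite sp.
  have Wd : W d by move: d Dd {xE}; exact: lin_span_sub.
  have z0 := radical0 form.
  have e : d + r = x + 0 by rewrite xE addr0.
  by have [<- _] := direct_sum_inj sW dW Wd Wx Vr z0 e.
- move=> a b [Wa [s [Vs Ras]]] [Wb [t [Vt Rbt]]].
  by rewrite -(cartan_mod_radical a b Vs Vt); exact: int.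
- move=> a b [Wa [s [Vs Ras]]] [Wb [t [Vt Rbt]]]; split.
    by apply: subspaceB => //; case: sW => _ _; apply.
  exists (t - cartan form b a *: s); split.
    exact: radicalB (radicalZ _ Vs).
  by rewrite -reflection_mod_radical//; exact: refl.
- move=> R1 R2 DE orth.
  pose lift (D : set V) := [set x | R x /\ exists a s, [/\ D a, V0 s & x = a + s]].
  have [||h|h] := irr (lift R1) (lift R2).
  + apply/seteqP; split=> [x Rx|x [[]|[]]//].
    have [a [s [Da Vs e]]] := ex_part _ Rx; move: Da; rewrite DE.
    by case=> Ra; [left|right]; split=> //; exists a, s.
  + move=> _ _ [_ [a [s [R1a Vs ->]]]] [_ [b [t [R2b Vt ->]]]].
    by rewrite form_mod_radical//; exact: orth.
  + left; apply/seteqP; split=> // a Ra; have : Delta a by rewrite DE; left.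
    case=> _ [s [Vs Ras]]; suff : set0 (a + s) by [].
    by rewrite -h; split=> //; exists a, s.
  + right; apply/seteqP; split=> // a Ra; have : Delta a by rewrite DE; right.
    case=> _ [s [Vs Ras]]; suff : set0 (a + s) by [].
    by rewrite -h; split=> //; exists a, s.
Qed.

Lemma bar_root_int a b : (barf @` R) a -> (barf @` R) b ->
  cartan (@bar_form V form) a b \is a Num.int.
Proof.
move=> [x Rx <-] [y Ry <-]; rewrite bar_cartan.
by case: RL => _ _ _ _ _ int _ _; exact: int.
Qed.

(** The Cartan number of a / 4 and a is 1/2. *)
Lemma half_root_indivisible a : (barf @` R) a ->
  ~ (barf @` R) (2^-1 *: (2^-1 *: a)).
Proof.
move=> Ra /bar_root_int/(_ Ra); have [x Rx <-] := Ra.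
have -> : 2^-1 *: (2^-1 *: barf x) = barf (2^-1 *: (2^-1 *: x)) by rewrite !barZ.
rewrite bar_cartan !cartanZl.
have -> : cartan form x x = 2 by rewrite /cartan mulfK//;
  case: RL => _ _ _ an _ _ _ _; exact: an.
by [].
Qed.

(** A root that is not indivisible is twice an indivisible one. *)
Lemma red_part_span : lin_span (red_part (barf @` R)) = [set: Vbar form].
Proof.
apply/seteqP; split=> // x _; have [y <-] := bar_surj x.
set U := lin_span _; have sU : subspace U := lin_span_subspace _.
have [U0 UD UZ] := sU.
suff : lin_span R `<=` [set z | U (barf z)].
  by move=> h; apply: h; case: RL => _ _ _ _ ->.
apply: lin_span_sub => [|z Rz /=].
  split=> [|u v /= Uu Uv|k u /= Uu]; [|by rewrite barD;
    exact: UD|by rewrite barZ; exact: UZ].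
  by rewrite /= (_ : barf 0 = 0)//; apply/bar_eq0; exact: radical0.
have Rbz : (barf @` R) (barf z) by exists z.
case: (pselect ((barf @` R) (2^-1 *: barf z))) => h.
  have -> : barf z = 2 *: (2^-1 *: barf z) by rewrite scalerA divff// scale1r.
  apply: UZ; apply: sub_lin_span; split=> //; right; exact: half_root_indivisible.
by apply: sub_lin_span; split=> //; right.
Qed.

Hypothesis RW : is_reflectable_subspace form R W.

Lemma reflectable_subspace : subspace W.
Proof. by case: RW => Pi [lift [_ _ ->]]; exact: lin_span_subspace. Qed.

(** The lifts of the reflectable base map to a basis of V / V0. *)
Lemma reflectable_direct_sum : direct_sum W V0.
Proof.
have sW := reflectable_subspace; have [W0 WD WZ] := sW.
case: RW => Pi [lift [[_ [indep span] _] liftP WE]].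
have WV0 x : W x -> V0 x -> x = 0.
  rewrite {1}WE => /lin_span_image [s [c [us sP ->]]] /bar_eq0;
    rewrite bar_sum => e.
  rewrite big_seq big1// => y ys; rewrite (indep s c us sP _ _ ys) ?scale0r//.
  rewrite -[RHS]e big_seq [RHS]big_seq; apply: eq_bigr => z zs.
  by have [_ ->] := liftP _ (sP _ zs).
split; last first.
  apply/seteqP; split=> [x [Wx Vx]|_ ->]; first exact: WV0.
  by split=> //; exact: radical0.
apply/seteqP; split=> // x _.
have : [set z | exists2 w, W w & barf w = z] (barf x).
  have : lin_span Pi (barf x) by rewrite span red_part_span.
  apply: lin_span_sub => [|z Pz]; last first.
    have [_ lz] := liftP _ Pz; exists (lift z) => //.
    by rewrite WE; apply: sub_lin_span; exists z.
  split=> [|_ _ [u Wu <-] [v Wv <-]|k _ [u Wu <-]].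
  - by exists 0 => //; apply/bar_eq0; exact: radical0.
  - by exists (u + v); [exact: WD|exact: barD].
  - by exists (k *: u); [exact: WZ|exact: barZ].
move=> [w Ww /esym/bar_eq Vxw]; exists w => //; exists (x - w) => //.
by rewrite addrC subrK.
Qed.

(** A word in the base that yields the class of a lifts to a word in elements
    of R lying in W; its value is in R and in W and has the same class as a,
    so it is a. *)
Lemma indivisible_in_R a : Delta a -> ~ Delta (2^-1 *: a) -> R a.
Proof.
move=> Da na; have sW := reflectable_subspace; have dW := reflectable_direct_sum.
have [Wa [s [Vs Ras]]] := Da; have [_ WD WZ] := sW.
have refl : forall a b, R a -> R b -> R (reflection form a b) by case: RL.
case: RW => Pi [lift [[_ _ word] liftP WE]].
have PiW p : Pi p -> W (lift p) by move=> Pp; rewrite WE; apply: sub_lin_span;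
  exists p.
have ra : red_part (barf @` R) (barf a).
  have ba : barf (a + s) = barf a by apply/bar_eq; rewrite addrC addKr.
  split; first by exists (a + s).
  right=> -[y Ry]; rewrite -barZ => /bar_eq h; apply: na; split; first exact: WZ.
  by exists (y - 2^-1 *: a); split=> //; rewrite addrC subrK.
have [w [p [wP Pp e]]] := word _ ra.
suff [b [Rb Wb be]] : exists b, [/\ R b, W b
  & barf b = foldr (reflection (@bar_form V form)) p w].
  suff -> : a = b by [].
  have z0 := radical0 form.
  have Vab : V0 (a - b) by apply/bar_eq; rewrite e be.
  have eab : a + 0 = b + (a - b) by rewrite addr0 addrC subrK.
  by have [] := direct_sum_inj sW dW Wa Wb z0 Vab eab.
elim: w wP {e} => [|q w IHw] wP /=; first by have [Rp <-] := liftP _ Pp;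
  exists (lift p); split; auto.
have [|b [Rb Wb <-]] := IHw; first by move=> x xw; apply: wP; rewrite inE xw orbT.
have Pq : Pi q by apply: wP; rewrite inE eqxx.
have [Rq eq] := liftP _ Pq; exists (reflection form (lift q) b); split;
  first exact: refl.
  by apply: subspaceB => //; apply: WZ; exact: PiW.
by rewrite -bar_reflection eq.
Qed.

End Decomposition.

(** * Systems of shifts *)

Section ShiftSystems.
Variables (V : lmodType rat) (form : {symmetric V}).
Implicit Types (Delta S L E : set V).
Local Notation V0 := (radical form).

(** The relations between S, L and E forced by the Cartan integers: two
    non-orthogonal roots of norm ratio k > 1 have Cartan integers 1 and k up
    to sign, which gives the coefficients 2, 4 and k, and an obtuse pair
    inside a class gives closure under addition. Relations on L and E are guarded by the existence
    of long and extra long roots, since these sets are arbitrary otherwise. *)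
Record shift_system Delta S L E : Prop := {
  shift_S0 : S 0;
  shift_SS2 : forall x y, S x -> S y -> S (x - 2 *: y);
  shift_LL2 : long_roots form Delta !=set0 ->
    forall x y, L x -> L y -> L (x - 2 *: y);
  shift_EE2 : extra_long_roots form Delta !=set0 ->
    forall x y, E x -> E y -> E (x - 2 *: y);
  shift_SL : long_roots form Delta !=set0 -> forall x y, S x -> L y -> S (x + y);
  shift_LS : forall a b k, short_roots form Delta a -> long_roots form Delta b ->
    form b b = k * form a a -> forall x y, S x -> L y -> L (k *: x + y);
  shift_SE : extra_long_roots form Delta !=set0 ->
    forall x y, S x -> E y -> S (x + y);
  shift_ES : extra_long_roots form Delta !=set0 ->
    forall x y, S x -> E y -> E (4 *: x + y);
  shift_LE : long_roots form Delta !=set0 -> extra_long_roots form Delta !=set0 ->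
    forall x y, L x -> E y -> L (x + y);
  shift_EL : long_roots form Delta !=set0 -> extra_long_roots form Delta !=set0 ->
    forall x y, L x -> E y -> E (2 *: x + y);
  shift_SS : has_obtuse_pair form (short_roots form Delta) ->
    forall x y, S x -> S y -> S (x + y);
  shift_LL : has_obtuse_pair form (long_roots form Delta) ->
    forall x y, L x -> L y -> L (x + y)
}.

Definition class_shift Delta S L E (a : V) : set V := [set s |
  [\/ short_roots form Delta a /\ S s, long_roots form Delta a /\ L s
    | extra_long_roots form Delta a /\ E s]].

Definition shifted_roots Delta (T : V -> set V) : set V :=
  [set x | exists a s, [/\ Delta a, T a s & x = a + s]].

Lemma reflection_spaceN S : (forall x y, S x -> S y -> S (x - 2 *: y)) ->
  forall x, S x -> S (- x).
Proof.
move=> h x Sx; have -> : - x = x - 2 *: x; last exact: h.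
by rewrite -{2}[x]scale1r -scalerBl -scaleN1r; congr (_ *: _).
Qed.

Section ClassShift.
Variables (W Delta S L E : set V).
Hypothesis rsys : is_lf_irr_root_system form W Delta.
Local Notation sh := (short_roots form Delta).
Local Notation lg := (long_roots form Delta).
Local Notation ex := (extra_long_roots form Delta).
Local Notation T := (class_shift Delta S L E).

Lemma class_shift_short a : sh a -> T a = S.
Proof.
move=> sa; have [h1 h2 _] := class_disjoint rsys a.
apply/seteqP; split=> [s [[]|[la _]|[xa _]]//|s Ss]; last exact: Or31.
  by case: h1.
by case: h2.
Qed.

Lemma class_shift_long a : lg a -> T a = L.
Proof.
move=> la; have [h1 _ h3] := class_disjoint rsys a.
apply/seteqP; split=> [s [[sa _]|[]|[xa _]]//|s Ls]; last exact: Or32.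
  by case: h1.
by case: h3.
Qed.

Lemma class_shift_extra a : ex a -> T a = E.
Proof.
move=> xa; have [_ h2 h3] := class_disjoint rsys a.
apply/seteqP; split=> [s [[sa _]|[la _]|[]]//|s Es]; last exact: Or33.
  by case: h2.
by case: h3.
Qed.

Lemma class_shift_reflection a b : Delta a -> Delta b -> T (reflection form a b)
  = T b.
Proof.
move=> Da Db; have [h1 h2 h3] := class_reflection rsys Da Db.
have [sb|lb|xb] := root_class form Db.
- by rewrite !class_shift_short//; exact: h1.
- by rewrite !class_shift_long//; exact: h2.
- by rewrite !class_shift_extra//; exact: h3.
Qed.

Hypothesis ssys : shift_system Delta S L E.

Lemma class_opp : [/\ forall a, sh a -> sh (- a), forall a, lg a -> lg (- a)
  & forall a, ex a -> ex (- a)].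
Proof.
have e a : Delta a -> - a = reflection form a a.
  by move=> Da; rewrite reflection_self// (root_norm_neq0 rsys).
by split=> a ha; have [Da _] := ha; rewrite e//;
  have [h1 h2 h3] := class_reflection rsys Da Da; auto.
Qed.

(** Unlike [nonorthogonal_roots], this covers orthogonal roots, and the
    proportional roots of norm ratio 4 like the others. *)
Lemma unequal_cartan a b k : Delta a -> Delta b -> 1 < k ->
  form b b = k * form a a ->
  [\/ cartan form a b = 0 /\ cartan form b a = 0,
      cartan form a b = 1 /\ cartan form b a = k
    | cartan form a b = -1 /\ cartan form b a = - k].
Proof.
move=> Da Db k1 e; have a0 := root_norm_gt0 rsys Da;
  have a00 := root_norm_neq0 rsys Da.
have [ab|ab] := eqVneq (form a b) 0.
  by apply: Or31; rewrite !cartan_eq0// formC.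
have le : form a a <= form b b by rewrite e; nra.
have [s [eb|eb|[i [hi [c1 c2 eb]]]]] := nonorthogonal_roots rsys Da Db ab le.
- by move: e; rewrite eb !formE signE; case: (s) => /=; nra.
- have k4 : k = 4.
    apply: (mulIf a00); rewrite -e eb !formE signE; case: (s) => /=; ring.
  rewrite k4 eb /cartan !formE signE; case: (s); [apply: Or33|apply: Or32];
    by split; field.
have ik : i = k by apply: (mulIf a00); rewrite -eb.
rewrite ik in c2; move: c1 c2; rewrite signE; case: (s) => c1 c2;
  [apply: Or33|apply: Or32].
  by rewrite c2 mulN1r.
by rewrite c2 mul1r.
Qed.

(** The relations of a shift system suffice for closure under reflections:
    they cover every Cartan integer that two roots of given classes can
    have. *)
Lemma class_shift_closed a b s t : Delta a -> Delta b -> T a s -> T b t ->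
  T b (t - cartan form b a *: s).
Proof.
have same (C X : set V) : C `<=` Delta -> (forall a, C a -> C (- a)) ->
    (forall a b, C a -> C b -> form a a = form b b) ->
    (forall x y, X x -> X y -> X (x - 2 *: y)) ->
    (has_obtuse_pair form C -> forall x y, X x -> X y -> X (x + y)) ->
    C a -> C b -> X s -> X t -> X (t - cartan form b a *: s).
  move=> CD CN Ce X2 Xo Ca Cb Xs Xt; have XN := reflection_spaceN X2.
  have [->|[-> _]|[-> _]|
    [/Xo XD [->|->]]] := equal_norm_cartan rsys CD CN Ca Cb (Ce _ _ Ca Cb).
  - by rewrite scale0r subr0.
  - exact: X2.
  - by rewrite scaleNr -scalerN; apply: X2 => //; exact: XN.
  - by rewrite scale1r; apply: XD => //; exact: XN.
  - by rewrite scaleN1r opprK; exact: XD.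
(* [up]: b has k times the norm of a, so its shift changes by 0 or k times
   that of a; [down]: the other way round, it changes by 0 or once. *)
have up (X Y : set V) k : Delta a -> Delta b -> 1 < k -> form b b = k * form a a ->
    (forall x y, X x -> X y -> X (x - 2 *: y)) ->
    (forall x y, X x -> Y y -> Y (k *: x + y)) ->
    X s -> Y t -> Y (t - cartan form b a *: s).
  move=> Da Db k1 e X2 XY Xs Yt; have XN := reflection_spaceN X2.
  have [[_ ->]|[_ ->]|[_ ->]] := unequal_cartan Da Db k1 e.
  - by rewrite scale0r subr0.
  - by rewrite -scalerN addrC; apply: XY => //; exact: XN.
  - by rewrite scaleNr opprK addrC; exact: XY.
have down (X Y : set V) k : Delta a -> Delta b -> 1 < k -> form a a = k * form b
  b ->
    (forall x y, Y x -> Y y -> Y (x - 2 *: y)) ->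
    (forall x y, X x -> Y y -> X (x + y)) ->
    Y s -> X t -> X (t - cartan form b a *: s).
  move=> Da Db k1 e Y2 XY Ys Xt; have YN := reflection_spaceN Y2.
  have [[-> _]|[-> _]|[-> _]] := unequal_cartan Db Da k1 e.
  - by rewrite scale0r subr0.
  - by rewrite scale1r; apply: XY => //; exact: YN.
  - by rewrite scaleN1r opprK; exact: XY.
move=> Da Db; have [shN lgN exN] := class_opp.
have [S0 S2 L2 E2 SL LS SE ES LE EL SS LL] := ssys.
have long_k x y : sh x -> lg y -> exists2 k, 1 < k & form y y = k * form x x.
  by move=> sx ly; have [->|->] := long_norm rsys sx ly; [exists 2|exists 3].
have cases x : Delta x -> [\/ sh x /\ T x = S, lg x /\ T x = L | ex x /\ T x = E].
  move=> Dx; have [h|h|h] := root_class form Dx.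
  - by apply: Or31; rewrite class_shift_short.
  - by apply: Or32; rewrite class_shift_long.
  - by apply: Or33; rewrite class_shift_extra.
have [[sa ->]|[la ->]|[xa ->]] := cases _ Da;
  have [[sb ->]|[lb ->]|[xb ->]] := cases _ Db.
- by apply: (same sh) => //; [move=> ? []|exact: short_norm].
- have [k k1 e] := long_k _ _ sa lb.
  by apply: (up S L k) => //; exact: LS e.
- apply: (up S E 4) => //; first exact: extra_norm sa xb.
  by apply: ES; exists b.
- have [k k1 e] := long_k _ _ sb la; apply: (down S L k) => //.
    by apply: L2; exists a.
  by apply: SL; exists a.
- apply: (same lg) => //; [by move=> ? []|exact: (long_norm_eq rsys)|].
  by apply: L2; exists a.
- apply: (up L E 2) => //; [exact: (long_extra_ratio rsys)|by apply: L2; exists a|].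
  by apply: EL; [exists a|exists b].
- apply: (down S E 4) => //; [exact: extra_norm sb xa|by apply: E2; exists a|].
  by apply: SE; exists a.
- apply: (down L E 2) => //; [exact: (long_extra_ratio rsys)|by apply: E2;
  exists a|].
  by apply: LE; [exists b|exists a].
- apply: (same ex) => //; [by move=> ? []| |by apply: E2; exists a|].
    move=> x y xx xy; have [c sc] := short_root_exists rsys.
    by rewrite (extra_norm sc xx) (extra_norm sc xy).
  by move=> /(extra_no_obtuse_extra rsys).
Qed.

End ClassShift.

(** * Constructing a LEARS from shifts *)
Section Construction.
Variables (W Delta : set V) (T : V -> set V).
Hypothesis rsys : is_lf_irr_root_system form W Delta.
Hypothesis dW : direct_sum W V0.
Hypothesis TV0 : forall a, Delta a -> T a `<=` V0.
Hypothesis Tn0 : forall a, Delta a -> T a !=set0.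
Hypothesis Trefl : forall a b s t, Delta a -> Delta b -> T a s -> T b t ->
  T (reflection form a b) (t - cartan form b a *: s).
Local Notation R := (shifted_roots Delta T).

Let sW : subspace W := root_span_subspace rsys.
Let DW a : Delta a -> W a := @root_in_span _ _ _ _ rsys a.

(** The hypothesis on shifts is exactly closure under reflections. The
    form does not see the shifts, so that of the other properties only the
    spanning condition involves them. *)
Lemma shifted_roots_lears : V0 `<=` lin_span R -> is_lears form [set: V] R.
Proof.
move=> spV0; have sR := lin_span_subspace R; have [R0 RD RZ] := sR.
split.
- by split.
- move=> x _; have [v [r [Wv Vr ->]]] := direct_sum_ex dW x.
  by rewrite form_mod_radical//; case: rsys => -[_ psd *]; exact: psd.
- have [a /short_root Da] := short_root_exists rsys; have [s Ts] := Tn0 Da.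
  by exists (a + s); exists a, s.
- move=> _ [a [s [Da /(TV0 Da) Vs ->]]]; rewrite form_mod_radical//.
  by case: rsys => -[_ _ _ an *]; exact: an.
- apply/seteqP; split=> // x _; have [v [r [Wv Vr ->]]] := direct_sum_ex dW x.
  apply: RD; last exact: spV0.
  have : lin_span Delta v by case: rsys => -[_ _ _ _ -> *].
  apply: lin_span_sub => // a Da; have [s Ts] := Tn0 Da.
  rewrite -[a](addrK s); apply: (subspaceB sR); last exact: spV0 (TV0 Da Ts).
  by apply: sub_lin_span; exists a, s.
- move=> _ _ [a [s [Da /(TV0 Da) Vs ->]]] [b [t [Db /(TV0 Db) Vt ->]]].
  by rewrite cartan_mod_radical//; exact: (root_int rsys Da Db).
- move=> _ _ [a [s [Da Ts ->]]] [b [t [Db Tt ->]]].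
  exists (reflection form a b), (t - cartan form b a *: s).
  split; [exact: (root_reflection rsys Da Db)|exact: Trefl|].
  by rewrite reflection_mod_radical//; [exact: TV0 Da _ Ts|exact: TV0 Db _ Tt].
- move=> R1 R2 RE orth.
  pose proj (X : set V) := [set a | Delta a /\ exists2 s, T a s & X (a + s)].
  have [||h|h] := root_irreducible rsys (R1 := proj R1) (R2 := proj R2).
  + apply/seteqP; split=> [a Da|a [[]|[]]//]; have [s Ts] := Tn0 Da.
    have : R (a + s) by exists a, s.
    by rewrite RE => -[h|h]; [left|right]; split=> //; exists s.
  + move=> a b [Da [s Ts R1s]] [Db [t Tt R2t]].
    rewrite -(form_mod_radical a b (TV0 Da Ts) (TV0 Db Tt)); exact: orth.
  + left; apply/seteqP; split=> // x R1x; have : R x by rewrite RE; left.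
    move=> [a [s [Da Ts e]]]; suff : set0 a by [].
    by rewrite -h; split=> //; exists s => //; rewrite -e.
  + right; apply/seteqP; split=> // x R2x; have : R x by rewrite RE; right.
    move=> [a [s [Da Ts e]]]; suff : set0 a by [].
    by rewrite -h; split=> //; exists s => //; rewrite -e.
Qed.

(** The inverse of the bijection of W onto V / V0, which is the isomorphism
    of the image of R with Delta. *)
Definition bar_section (x : Vbar form) : V :=
  xget 0 [set w | W w /\ @bar V form w = x].

Lemma bar_sectionP x : W (bar_section x) /\ @bar V form (bar_section x) = x.
Proof.
rewrite /bar_section; case: xgetP => [w -> //|none].
have [y yx] := bar_surj x; have [v [r [Wv Vr e]]] := direct_sum_ex dW y.
case: (none v); split=> //; rewrite -yx; apply/bar_eq;
  rewrite e opprD addrA subrr add0r -scaleN1r.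
exact: radicalZ.
Qed.

Lemma bar_inj_on w v : W w -> W v -> @bar V form w = @bar V form v -> w = v.
Proof.
move=> Ww Wv /bar_eq Vwv; have z0 := radical0 form.
have e : w + 0 = v + (w - v) by rewrite addr0 addrC subrK.
by have [] := direct_sum_inj sW dW Ww Wv z0 Vwv e.
Qed.

Lemma bar_section_linear : linear bar_section.
Proof.
move=> k x y; have [W0 WD WZ] := sW.
have [[Wx bx] [Wy b_y]] := (bar_sectionP x, bar_sectionP y).
have [Wz bz] := bar_sectionP (k *: x + y).
apply: bar_inj_on => //; first by apply: WD => //; exact: WZ.
by rewrite bz barD barZ bx b_y.
Qed.

Lemma shifted_roots_type : has_type form R Delta.
Proof.
pose lin := GRing.isLinear.Build rat (Vbar form) V *:%R bar_section
  bar_section_linear.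
pose f : {linear Vbar form -> V} := HB.pack bar_section lin.
have fE w : W w -> bar_section (@bar V form w) = w.
  by move=> Ww; have [? ?] := bar_sectionP (@bar V form w); exact: bar_inj_on.
have fR a s : Delta a -> T a s -> bar_section (@bar V form (a + s)) = a.
  move=> Da Ts; rewrite -[RHS]fE; last exact: DW.
  by congr bar_section; apply/bar_eq; rewrite addrC addKr; exact: TV0 Da _ Ts.
exists f; split.
- move=> x y _ _ /= e; have [_ <-] := bar_sectionP x.
  by have [_ <-] := bar_sectionP y; rewrite e.
- apply/seteqP; split=> [_ [_ [_ [a [s [Da Ts ->]]] <-] <-]|a Da] /=.
    by rewrite fR.
  have [s Ts] := Tn0 Da; exists (@bar V form (a + s)); last exact: fR.
  by exists (a + s) => //; exists a, s.
- move=> _ _ [_ [a [s [Da Ts ->]]] <-] [_ [b [t [Db Tt ->]]] <-] /=.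
  by rewrite !fR// bar_cartan cartan_mod_radical//;
    [exact: TV0 Da _ Ts|exact: TV0 Db _ Tt].
Qed.

End Construction.

(** * The shifts of a LEARS *)
Section Shifts.
Variables (R W : set V).
Hypothesis RL : is_lears form [set: V] R.
Hypothesis RW : is_reflectable_subspace form R W.
Local Notation Delta := (root_part form R W).
Local Notation sh := (short_roots form Delta).
Local Notation lg := (long_roots form Delta).
Local Notation ex := (extra_long_roots form Delta).
Local Notation T := (root_shifts form R).

Let sW : subspace W := reflectable_subspace RW.
Let dW : direct_sum W V0 := reflectable_direct_sum RL RW.
Let rsys : is_lf_irr_root_system form W Delta := root_part_system RL sW dW.

Lemma shifts_reflection a b s t : T a s -> T b t ->
  T (reflection form a b) (t - cartan form b a *: s).
Proof.
move=> [Vs Ras] [Vt Rbt]; split; first exact: radicalB (radicalZ _ Vs).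
by rewrite -reflection_mod_radical//; case: RL => _ _ _ _ _ _ refl _; exact: refl.
Qed.

Lemma shifts0 a : Delta a -> ~ Delta (2^-1 *: a) -> T a 0.
Proof.
move=> Da na; split; first exact: radical0.
by rewrite addr0; exact: (indivisible_in_R RL RW).
Qed.

Lemma double_reflection a b : form a a != 0 ->
  reflection form (2^-1 *: a) b = reflection form a b.
Proof.
move=> a0; rewrite /reflection scalerA; congr (_ - _ *: _).
rewrite /cartan !formE; field; exact: a0.
Qed.

(** Reflecting in a root with zero shift leaves shifts unchanged. *)
Lemma shifts_invariant a b : Delta a -> Delta b -> T (reflection form a b) = T b.
Proof.
have incl a0 b0 : Delta a0 -> T a0 0 -> T b0 `<=` T (reflection form a0 b0).
  move=> _ T0 t Tt; have := shifts_reflection T0 Tt.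
  by rewrite scaler0 subr0.
have inv a0 b0 : Delta a0 -> T a0 0 -> T (reflection form a0 b0) = T b0.
  move=> Da0 T0; apply/seteqP; split; last exact: incl.
  by rewrite -{2}(reflectionK (root_norm_neq0 rsys Da0) b0); exact: incl.
(* If a has no zero shift, then a / 2 is a root with a zero shift, and it
   defines the same reflection. *)
move=> Da Db; case: (pselect (Delta (2^-1 *: a))) => h; last by apply: inv => //;
  exact: shifts0.
rewrite -double_reflection ?(root_norm_neq0 rsys Da)//; apply: inv => //;
  apply: shifts0 => // h4.
have := root_int rsys h4 Da;
  rewrite !cartanZl /cartan mulfK ?(root_norm_neq0 rsys Da)//.
Qed.

Lemma shifts_norm a b : Delta a -> Delta b -> form a a = form b b -> T a = T b.
Proof.
move=> Da Db e; apply: (@equal_norm_ind _ _ _ _ rsys (fun c => T a = T c) a b) =>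
  //.
by move=> c d Dc Dd ->; rewrite shifts_invariant.
Qed.

Definition shift_union (C : set V) : set V := \bigcup_(a in C) T a.
Local Notation S := (shift_union sh).
Local Notation L := (shift_union lg).
Local Notation E := (shift_union ex).

Lemma shift_unionE C a : C `<=` Delta ->
  (forall a b, C a -> C b -> form a a = form b b) -> C a -> T a = shift_union C.
Proof.
move=> CD Ce Ca; apply/seteqP; split=> [s Ts|s [b Cb]]; first by exists a.
by rewrite (@shifts_norm b a)//; [exact: CD|exact: CD|exact: Ce].
Qed.

Lemma short_shiftsE a : sh a -> T a = S.
Proof. by apply: shift_unionE => [? []|b c sb sc]//; exact: (short_norm sb sc). Qed.

Lemma long_shiftsE a : lg a -> T a = L.
Proof. by apply: shift_unionE => [? []|b c lb lc]//;
  exact: (long_norm_eq rsys). Qed.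

Lemma extra_shiftsE a : ex a -> T a = E.
Proof.
apply: shift_unionE => [? []|b c xb xc]//; have [d sd] := short_root_exists rsys.
by rewrite (extra_norm sd xb) (extra_norm sd xc).
Qed.

Lemma short_shifts0 : S 0.
Proof.
have [a sa] := short_root_exists rsys; rewrite -(short_shiftsE sa);
  have [Da amin] := sa.
apply: shifts0 => // /amin; rewrite !formE; have := root_norm_gt0 rsys Da; lra.
Qed.

Lemma long_shifts0 : lg !=set0 -> L 0.
Proof.
move=> [a la]; rewrite -(long_shiftsE la); apply: shifts0 => [|h];
  first by case: la.
have [c sc] := short_root_exists rsys; have [_ /(_ _ h)] := sc.
rewrite !formE; have := root_norm_gt0 rsys (short_root sc).
by have [->|->] := long_norm rsys sc la; lra.
Qed.

Lemma obtuse_shifts (X Y : set V) a b j : T a = X -> T b = Y -> Delta a -> Delta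
  b ->
  cartan form b a = - j ->
  forall x y, X x -> Y y -> Y (j *: x + y).
Proof.
move=> <- <- Da Db e x y Tx Ty; have := shifts_reflection Tx Ty.
by rewrite shifts_invariant// e scaleNr opprK addrC.
Qed.

Lemma same_shifts a : Delta a -> forall x y, T a x -> T a y -> T a (x - 2 *: y).
Proof.
move=> Da x y Tx Ty; have := shifts_reflection Ty Tx.
by rewrite shifts_invariant// /cartan mulfK ?(root_norm_neq0 rsys Da).
Qed.

(** Apart from [short_shifts0] and [same_shifts], each relation is
    [obtuse_shifts] at one pair of roots, provided by [obtuse_pair] when the norm ratio is 2 or 3. *)
Lemma shifts_system : shift_system Delta S L E.
Proof.
have [c sc] := short_root_exists rsys; have Dc := short_root sc.
have obt a b j : Delta a -> Delta b -> 1 < j < 4 -> form b b = j * form a a ->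
    (forall x y, T a x -> T b y -> T a (x + y)) /\
    (forall x y, T a x -> T b y -> T b (j *: x + y)).
  move=> Da Db hj e; have [a' [Da' a'a c1 c2]] := obtuse_pair rsys Da Db hj e.
  have Taa := shifts_norm Da' Da a'a.
  split=> [x y Tx Ty|]; last exact: (obtuse_shifts Taa erefl Da' Db).
  by rewrite addrC -[y]scale1r; apply: (obtuse_shifts erefl Taa Db Da' c1).
have self (C : set V) : C `<=` Delta -> (forall a, C a -> T a = shift_union C) ->
    has_obtuse_pair form C ->
    forall x y, shift_union C x -> shift_union C y -> shift_union C (x + y).
  move=> CD CE [a [b [Ca Cb e]]] x y Sx Sy; rewrite addrC -[y]scale1r.
  by apply: (obtuse_shifts (CE _ Cb) (CE _ Ca) (CD _ Cb) (CD _ Ca)).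
split.
- exact: short_shifts0.
- by rewrite -(short_shiftsE sc); exact: same_shifts.
- by move=> [b lb]; rewrite -(long_shiftsE lb); apply: same_shifts; case: lb.
- by move=> [b xb]; rewrite -(extra_shiftsE xb); apply: same_shifts; case: xb.
- move=> [b lb]; rewrite -(short_shiftsE sc) -(long_shiftsE lb).
  have [e|e] := long_norm rsys sc lb.
    by case: (obt _ _ 2 Dc (long_root lb) isT e).
  by case: (obt _ _ 3 Dc (long_root lb) isT e).
- move=> a b k sa lb e; rewrite -(short_shiftsE sa) -(long_shiftsE lb).
  have hk : 1 < k < 4.
    have a0 := root_norm_gt0 rsys (short_root sa).
    by have [e'|e'] := long_norm rsys sa lb;
      have -> := mulIf (lt0r_neq0 a0) (etrans (esym e) e').
  by have [_ h] := obt _ _ _ (short_root sa) (long_root lb) hk e.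
(* A short root b and the extra long root 2 b, of Cartan integers 1 and 4,
   make an obtuse pair once b is replaced by - b. *)
- move=> [z [D2 [b sb e2]]] x y Sx Ey; rewrite e2 in D2.
  have xb : ex (2 *: b) by split=> //; exists b.
  have Db := short_root sb; have DN := root_opp rsys Db.
  have TN : T (- b) = S.
    by rewrite -(short_shiftsE sb); apply: shifts_norm; rewrite // !formE opprK.
  rewrite addrC -[y]scale1r.
  apply: (obtuse_shifts (extra_shiftsE xb) TN D2 DN) => //.
  rewrite cartanNl /cartan !formE; field; exact: (root_norm_neq0 rsys Db).
- move=> [z [D2 [b sb e2]]] x y Sx Ey; rewrite e2 in D2.
  have xb : ex (2 *: b) by split=> //; exists b.
  have Db := short_root sb; have DN := root_opp rsys Db.
  have TN : T (- b) = S.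
    by rewrite -(short_shiftsE sb); apply: shifts_norm; rewrite // !formE opprK.
  apply: (obtuse_shifts TN (extra_shiftsE xb) DN D2) => //.
  rewrite cartanNr /cartan !formE; field; exact: (root_norm_neq0 rsys Db).
- move=> [b lb] [d xd]; rewrite -(long_shiftsE lb) -(extra_shiftsE xd).
  by case: (obt _ _ 2 (long_root lb) (extra_root xd) isT (long_extra_ratio rsys
    lb xd)).
- move=> [b lb] [d xd]; rewrite -(long_shiftsE lb) -(extra_shiftsE xd).
  by case: (obt _ _ 2 (long_root lb) (extra_root xd) isT (long_extra_ratio rsys
    lb xd)).
- by apply: self short_shiftsE; move=> ? [].
- by apply: self long_shiftsE; move=> ? [].
Qed.

Lemma shifts_class a : Delta a -> T a = class_shift Delta S L E a.
Proof.
move=> Da; have [h|h|h] := root_class form Da.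
- by rewrite (class_shift_short _ _ _ rsys)// short_shiftsE.
- by rewrite (class_shift_long _ _ _ rsys)// long_shiftsE.
- by rewrite (class_shift_extra _ _ _ rsys)// extra_shiftsE.
Qed.

Lemma lears_shifted_roots : R = shifted_roots Delta (class_shift Delta S L E).
Proof.
apply/seteqP; split=> [x Rx|_ [a [s [Da Ts ->]]]]; last first.
  by move: Ts; rewrite -shifts_class// => -[].
have [v [r [Wv Vr e]]] := direct_sum_ex dW x; rewrite e in Rx *.
have Dv : Delta v by split=> //; exists r.
by exists v, r; split=> //; rewrite -shifts_class.
Qed.

End Shifts.
End ShiftSystems.

(** * Coordinates *)

Lemma card_geP (T : choiceType) n :
  (`I_n #<= [set: T])%card <-> exists s : seq T, uniq s /\ size s = n.
Proof.
split=> [/card_leP[f]|[s [us <-]]]; last first.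
  case: s us => [|x s] us; first by rewrite II0.
  suff [g] : $|{injfun `I_(size (x :: s)) >-> [set: T]}| by exact: inj_card_le.
  apply/injfunPex; exists (nth x (x :: s)) => // i j /set_mem hi /set_mem hj e.
  by apply/eqP; rewrite -(nth_uniq x hi hj us) e.
have memI (i : 'I_n) : (i : nat) \in `I_n by rewrite inE /=.
pose g (i : 'I_n) : T := val (f (SigSub (memI i))).
exists (map g (enum 'I_n)); split; last by rewrite size_map size_enum_ord.
rewrite map_inj_uniq ?enum_uniq// => i j /val_inj.
by move/(inj (in_setT _) (in_setT _)) => /(congr1 val) /= /val_inj.
Qed.

Lemma card_ge3 (T : choiceType) (i j k : T) :
  i != j -> k != i -> k != j -> (`I_3 #<= [set: T])%card.
Proof.
move=> ij ki kj; apply/card_geP; exists [:: i; j; k]; split=> //=.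
by rewrite !inE negb_or ij eq_sym ki eq_sym kj.
Qed.

Section Dot.
Variable I : choiceType.
Implicit Types (x y z : I -> rat^o).
Local Notation N x := (dot I x x).

Lemma fctD x y i : (x + y) i = x i + y i. Proof. by []. Qed.
Lemma fctN x i : (- x) i = - x i. Proof. by []. Qed.
Lemma fctZ (k : rat) x i : (k *: x) i = k * x i. Proof. by []. Qed.
Lemma epsE (i j : I) : eps i j = (i == j)%:R :> rat. Proof. by []. Qed.
Definition coordE := (@fctD, @fctN, @fctZ, @epsE).

Definition finite_support x := exists s : seq I, forall i, x i != 0 -> i \in s.

Lemma finite_supportD x y : finite_support x -> finite_support y ->
  finite_support (x + y).
Proof.
move=> [s sx] [t ty]; exists (s ++ t) => i; rewrite mem_cat fctD => xy0.
by apply/orP; have [x0|/sx] := eqVneq (x i) 0; [right; apply: ty;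
  rewrite x0 add0r in xy0|left].
Qed.

Lemma finite_supportZ k x : finite_support x -> finite_support (k *: x).
Proof. by move=> [s sx]; exists s => i;
  rewrite fctZ mulf_eq0 negb_or => /andP[_ /sx]. Qed.

Lemma finite_support_eps (i : I) : finite_support (eps i).
Proof.
by exists [:: i] => j; rewrite epsE inE (eq_sym j); case: (i == j).
Qed.

(** The sum that defines the product ranges over all of I; the finite support
    of one factor makes it a finite sum. *)
Lemma dotE (s : seq I) x y : uniq s -> (forall i, x i != 0 -> i \in s) ->
  dot I x y = \sum_(i <- s) x i * y i.
Proof.
move=> us sx; rewrite /dot (fsbigE s)//.
  by apply: eq_bigl => i; rewrite in_setT.
move=> i _ /negP is_; have [->|/sx//] := eqVneq (x i) 0; exact: mul0r.
Qed.

Lemma dotC x y : dot I x y = dot I y x.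
Proof. by apply: eq_fsbigr => i _; exact: mulrC. Qed.

Lemma dotDl x y z : finite_support x -> finite_support y ->
  dot I (x + y) z = dot I x z + dot I y z.
Proof.
move=> [s sx] [t ty]; pose r := undup (s ++ t).
have ur : uniq r := undup_uniq _.
have xr i : x i != 0 -> i \in r by move=> /sx si; rewrite mem_undup mem_cat si.
have yr i : y i != 0 -> i \in r by move=> /ty ti; rewrite mem_undup mem_cat ti orbT.
rewrite (dotE _ ur xr) (dotE _ ur yr) (dotE (s := r))//.
  by rewrite -big_split; apply: eq_bigr => i _; rewrite fctD mulrDl.
move=> i; rewrite fctD => h; have [x0|/xr//] := eqVneq (x i) 0.
by apply: yr; rewrite x0 add0r in h.
Qed.

Lemma dotZl k x y : finite_support x -> dot I (k *: x) y = k * dot I x y.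
Proof.
move=> [s sx]; have ur : uniq (undup s) := undup_uniq _.
have xs i : x i != 0 -> i \in undup s by move=> /sx; rewrite mem_undup.
rewrite (dotE _ ur xs) (dotE (s := undup s))//.
  by rewrite mulr_sumr; apply: eq_bigr => i _; rewrite fctZ mulrA.
by move=> i; rewrite fctZ mulf_eq0 negb_or => /andP[_ /xs].
Qed.

Lemma dot_eps (i : I) y : dot I (eps i) y = y i.
Proof.
rewrite (dotE (s := [:: i]))// ?big_seq1 ?epsE ?eqxx ?mul1r// => j.
by rewrite epsE inE (eq_sym j); case: (i == j).
Qed.

Lemma dot1 k (i : I) y : dot I (k *: eps i) y = k * y i.
Proof. by rewrite dotZl ?dot_eps//; exact: finite_support_eps. Qed.

Lemma dot2 k l (i j : I) y : dot I (k *: eps i + l *: eps j) y = k * y i + l * y j.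
Proof. by rewrite dotDl ?dot1//; apply: finite_supportZ;
  exact: finite_support_eps. Qed.

Lemma dotDr x y z : finite_support x -> finite_support y ->
  dot I z (x + y) = dot I z x + dot I z y.
Proof. by move=> fx fy; rewrite dotC dotDl// !(dotC z). Qed.

Lemma dotZr k x y : finite_support x -> dot I y (k *: x) = k * dot I y x.
Proof. by move=> fx; rewrite dotC dotZl// (dotC y). Qed.

Lemma dot_reflection x y : finite_support x -> finite_support y ->
  N (reflection (dot I) x y) = N y.
Proof.
move=> fx fy; rewrite /reflection -scaleNr.
have fz : finite_support (- cartan (dot I) y x *: x) by exact: finite_supportZ.
rewrite !(dotDl, dotDr, dotZl, dotZr) //; try exact: finite_supportD.
rewrite /cartan (dotC x y); have [->|x0] := eqVneq (dot I x x) 0.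
  by rewrite invr0; ring.
by field.
Qed.

End Dot.

Lemma dot_ord n (x y : 'I_n -> rat^o) : dot 'I_n x y = \sum_(i < n) x i * y i.
Proof.
by rewrite (dotE (s := enum 'I_n)) ?enum_uniq// ?big_enum// => i _;
  rewrite mem_enum.
Qed.

(** * Norms and obtuse pairs of a root system *)

(** All that the relations between S, L and E retain of a root system: k is
    the norm of long roots relative to short ones ([None] if there are no
    long roots), x tells whether extra long roots exist, osh and olg when
    there are obtuse pairs of short, respectively long, roots. *)
Record profile (V : lmodType rat) (form : {symmetric V}) (Delta : set V)
    (k : option rat) (x : bool) (osh olg : Prop) : Prop := {
  profile_long : if k is Some c then long_roots form Delta !=set0 /\
      forall a b, short_roots form Delta a -> long_roots form Delta b ->
        form b b = c * form a a
    else long_roots form Delta = set0;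
  profile_extra : if x then extra_long_roots form Delta !=set0
    else extra_long_roots form Delta = set0;
  profile_obtuse_short : has_obtuse_pair form (short_roots form Delta) <-> osh;
  profile_obtuse_long : has_obtuse_pair form (long_roots form Delta) <-> olg
}.

(** The same data read on coordinates, m being the norm of short roots. *)
Record coordinate_profile (I : choiceType) (Std : set (I -> rat^o)) (m : rat)
    (k : option rat) (x : bool) (osh olg : Prop) : Prop := {
  coord_support : forall u, Std u -> finite_support u;
  coord_gt0 : 0 < m;
  coord_ratio : if k is Some c then c = 2 \/ c = 3 else true;
  coord_norm : forall u, Std u -> [\/ dot I u u = m,
    (if k is Some c then dot I u u = c * m else False)
    | x /\ dot I u u = 4 * m];
  coord_short : exists2 u, Std u & dot I u u = m;
  coord_long : if k is Some c then exists2 u, Std u & dot I u u = c * m else True;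
  coord_extra : x -> exists2 u, Std u & dot I u u = 4 * m;
  coord_obtuse_short : (exists u v, [/\ Std u /\ dot I u u = m,
    Std v /\ dot I v v = m & cartan (dot I) u v = -1]) <-> osh;
  coord_obtuse_long : (if k is Some c then
    exists u v, [/\ Std u /\ dot I u u = c * m,
    Std v /\ dot I v v = c * m & cartan (dot I) u v = -1] else False) <-> olg
}.

Section Transfer.
Variables (V : lmodType rat) (form : {symmetric V}) (W Delta : set V).
Hypothesis rsys : is_lf_irr_root_system form W Delta.
Variables (I : choiceType) (Std : set (I -> rat^o)) (f : {linear V -> (I ->
  rat^o)}).
Hypothesis fs : forall u, Std u -> finite_support u.
Hypothesis fStd : forall a, Delta a -> Std (f a).
Hypothesis fcartan : forall a b, Delta a -> Delta b ->
  cartan (dot I) (f a) (f b) = cartan form a b.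
Local Notation N x := (dot I x x).

(** An isomorphism of root systems is a similarity: norm ratios of
    non-orthogonal roots are quotients of Cartan integers, and irreducibility
    links any two roots up to reflections, which the isomorphism respects. *)
Lemma iso_similarity a b : Delta a -> Delta b ->
  form b b * N (f a) = form a a * N (f b).
Proof.
move=> Da Db; pose P c := form c c = form a a /\ N (f c) = N (f a).
have Pinv c d : Delta c -> Delta d -> P d -> P (reflection form c d).
  move=> Dc Dd [e1 e2]; split; first by rewrite form_reflection.
  have -> : f (reflection form c d) = reflection (dot I) (f c) (f d).
    by rewrite /reflection linearB linearZ /= fcartan.
  by rewrite dot_reflection//; apply: fs; exact: fStd.
have [c [Dc [ca fca] cb]] := invariant_meets rsys Pinv Da (conj erefl erefl) Db.
rewrite -ca -fca.
have h1 := fcartan Dc Db; have h2 := fcartan Db Dc.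
have b0 := root_norm_neq0 rsys Db; have c0 := root_norm_neq0 rsys Dc.
move: h1 h2; rewrite /cartan (dotC (f b)) (formC form b c).
move: (dot I (f c) (f b)) (N (f b)) (N (f c)) => D nb nc.
move: (form c b) (form b b) (form c c) cb b0 c0 => F qb qc F0 b0 c0 h1 h2.
have D0 : D != 0.
  by apply: contra_neq F0 => D0; apply/eqP; move/eqP: h1;
    rewrite D0 mulr0 mul0r eq_sym
    mulf_eq0 invr_eq0 (negPf b0) orbF mulf_eq0 /=.
have nb0 : nb != 0.
  apply: contra_neq F0 => n0; apply/eqP; move/eqP: h1; rewrite n0 invr0 mulr0 eq_sym
    mulf_eq0 invr_eq0 (negPf b0) orbF mulf_eq0 //=.
have nc0 : nc != 0.
  apply: contra_neq F0 => n0; apply/eqP; move/eqP: h2; rewrite n0 invr0 mulr0 eq_sym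
    mulf_eq0 invr_eq0 (negPf c0) orbF mulf_eq0 //=.
have e1 : D * qb = F * nb.
  apply: (mulfI (_ : 2 / (nb * qb) != 0));
    first by rewrite mulf_neq0 ?invr_eq0 ?mulf_neq0.
  by transitivity (2 * D / nb); [|rewrite h1]; field; rewrite b0 nb0.
have e2 : D * qc = F * nc.
  apply: (mulfI (_ : 2 / (nc * qc) != 0));
    first by rewrite mulf_neq0 ?invr_eq0 ?mulf_neq0.
  by transitivity (2 * D / nc); [|rewrite h2]; field; rewrite c0 nc0.
apply: (mulfI (_ : F * D != 0)); first by rewrite mulf_neq0.
transitivity ((D * qb) * (F * nc)); first by ring.
by rewrite e1 -e2; ring.
Qed.

End Transfer.

(** By [iso_similarity] the classes of roots are read on the norms of their
    coordinates. *)
Lemma profile_transfer (V : lmodType rat) (form : {symmetric V}) (W Delta : set V)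
  (I : choiceType) (Std : set (I -> rat^o)) m k x osh olg :
  is_lf_irr_root_system form W Delta -> root_iso form Delta (dot I) Std ->
  coordinate_profile Std m k x osh olg -> profile form Delta k x osh olg.
Proof.
move=> rsys [f [_ fD fcartan]] [fs m0 hk norms [u0 Su0 nu0] hlong hextra hosh holg].
have fStd a : Delta a -> Std (f a) by move=> Da; rewrite -fD; exists a.
have fsurj u : Std u -> exists2 a, Delta a & f a = u
  by rewrite -fD => -[a Da <-]; exists a.
have sim := iso_similarity rsys fs fStd fcartan.
have [a0 Da0 fa0] := fsurj _ Su0; have q0 := root_norm_gt0 rsys Da0.
have qE b : Delta b -> form b b * m = form a0 a0 * dot I (f b) (f b).
  by move=> Db; rewrite -nu0 -fa0 sim.
have ge_m u : Std u -> m <= dot I u u.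
  move=> Su; have [->//|h|[_ ->]] := norms _ Su; last by nra.
  by case: k hk h {norms hlong holg} => // c hc ->; case: hc => ->; nra.
have sa0 : short_roots form Delta a0.
  split=> // b Db; rewrite -(ler_pM2r m0) (qE b Db) ler_pM2l//.
  by apply: ge_m; exact: fStd.
have shE b : Delta b -> short_roots form Delta b <-> dot I (f b) (f b) = m.
  move=> Db; have := qE b Db; split=> [sb|e].
    by apply: (mulfI (lt0r_neq0 q0)); rewrite -(qE b Db) (short_norm sa0 sb).
  apply: (short_normE sa0 Db); apply: (mulIf (lt0r_neq0 m0)).
  by rewrite (qE b Db) e.
have exE b : Delta b -> extra_long_roots form Delta b <-> dot I (f b) (f b) = 4 * m.
  move=> Db; have := qE b Db; split=> [xb|e].
    by apply: (mulfI (lt0r_neq0 q0)); rewrite -(qE b Db) (extra_norm sa0 xb); ring.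
  apply: (extra_normE rsys sa0 Db); apply: (mulIf (lt0r_neq0 m0)).
  by rewrite (qE b Db) e; ring.
have lgE b : Delta b -> long_roots form Delta b <->
    (if k is Some c then dot I (f b) (f b) = c * m else False).
  move=> Db; have [d1 d2 d3] := class_disjoint rsys b.
  split=> [lb|h].
    have [/(shE _ Db) sb|//|[_ /(exE _ Db) xb]] := norms _ (fStd _ Db).
      by case: d1.
    by case: d3.
  have [/(shE _ Db) e|//|/(exE _ Db) e] := root_class form Db; exfalso;
    case: k hk h {norms hlong holg} => // c hc; rewrite e; case: hc => ->; nra.
split.
- case: k lgE hlong {norms holg hk} => [c|] lgE hlong.
    split; first by case: hlong => u Su nu; have [a Da fa] := fsurj _ Su; exists a;
      apply/lgE; rewrite ?fa.
    move=> a b sa lb; rewrite (short_norm sa sa0).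
    have Db := long_root lb; apply: (mulIf (lt0r_neq0 m0)).
    by rewrite (qE b Db) (proj1 (lgE b Db) lb); ring.
  by apply/seteqP; split=> // b lb; case: (proj1 (lgE b (long_root lb)) lb).
- case: x norms hextra => norms hextra.
    by have [u Su nu] := hextra isT; have [a Da fa] := fsurj _ Su; exists a;
      apply/exE; rewrite ?fa.
  apply/seteqP; split=> // b xb; have Db := extra_root xb.
  have e := proj1 (exE b Db) xb; have [h|h|[]//] := norms _ (fStd _ Db).
    by move: h; rewrite e; nra.
  by case: k hk h {norms hlong holg lgE} => // c hc; rewrite e; case: hc => ->; nra.
- rewrite -hosh; split=> [[a [b [sa sb ab]]]|[u [v [[Su nu] [Sv nv] uv]]]].
    have [Da Db] := (short_root sa, short_root sb).
    exists (f a), (f b); rewrite fcartan//.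
    by split; [split; [exact: fStd|apply/shE]|split; [exact: fStd|apply/shE]|].
  have [[a Da fa] [b Db fb]] := (fsurj _ Su, fsurj _ Sv).
  exists a, b; rewrite -fcartan// fa fb; split=> //.
    by apply/(shE _ Da); rewrite fa.
  by apply/(shE _ Db); rewrite fb.
- rewrite -holg; case: k lgE {norms hk hlong holg} => [c|] lgE; last first.
    split=> // -[a [b [la lb ab]]].
    by case: (proj1 (lgE _ (long_root la)) la).
  split=> [[a [b [sa sb ab]]]|[u [v [[Su nu] [Sv nv] uv]]]].
    have [Da Db] := (long_root sa, long_root sb).
    exists (f a), (f b); rewrite fcartan//.
    by split; [split; [exact: fStd|apply/lgE]|split; [exact: fStd|apply/lgE]|].
  have [[a Da fa] [b Db fb]] := (fsurj _ Su, fsurj _ Sv).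
  exists a, b; rewrite -fcartan// fa fb; split=> //.
    by apply/(lgE _ Da); rewrite fa.
  by apply/(lgE _ Db); rewrite fb.
Qed.

(** * The standard root systems *)

Section Coordinates.
Variable I : choiceType.
Implicit Types (u v : I -> rat^o) (i j : I).
Local Notation N u := (dot I u u).

Lemma norm_eps k i : dot I (k *: eps i) (k *: eps i) = k * k.
Proof. by rewrite dot1 !coordE eqxx mulr1. Qed.

Lemma norm_rootD u : rootD I u -> N u = 2.
Proof.
move=> [i [j [a [b [ij ->]]]]]; rewrite dot2 !coordE !eqxx (eq_sym j i) (negPf ij).
by rewrite !signE; case: a; case: b.
Qed.

Lemma finite_support_rootD u : rootD I u -> finite_support u.
Proof.
move=> [i [j [a [b [_ ->]]]]].
by apply: finite_supportD; apply: finite_supportZ; exact: finite_support_eps.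
Qed.

Lemma rootA_rootD u : rootA I u -> rootD I u.
Proof.
move=> [i [j [ij ->]]]; exists i, j, false, true; split=> //.
by rewrite !signE scale1r scaleN1r.
Qed.

Lemma rootA_eps i j : i != j -> rootA I (eps i - eps j).
Proof. by move=> ij; exists i, j. Qed.

(** The product of two vectors of this form on the same two coordinates is
    0, 2 or -2, so a Cartan integer -1 takes a third index. *)
Lemma obtuse_rootD u v : rootD I u -> rootD I v -> cartan (dot I) u v = -1 ->
  (`I_3 #<= [set: I])%card.
Proof.
move=> Du Dv; rewrite /cartan (norm_rootD Dv) mulrAC divff// mul1r.
move: Du Dv => [i [j [a [b [ij ->]]]]] [k [l [c [d [kl ->]]]]].
case: (eqVneq k i) => [ki|ki]; last first.
  case: (eqVneq k j) => [kj|kj]; last by move=> _; exact: card_ge3 ij ki kj.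
  case: (eqVneq l i) => [li|li]; last first.
    by move=> _; apply: (card_ge3 ij li); rewrite -kj eq_sym.
  rewrite dot2 !coordE kj li !eqxx (eq_sym j i) (negPf ij) !signE.
  by case: a; case: b; case: c; case: d.
case: (eqVneq l j) => [lj|lj]; last first.
  by move=> _; apply: (card_ge3 ij _ lj); rewrite -ki eq_sym.
rewrite dot2 !coordE ki lj !eqxx (eq_sym j i) (negPf ij) !signE.
by case: a; case: b; case: c; case: d.
Qed.

Lemma obtuse_eps i j k : i != j -> k != i -> k != j ->
  cartan (dot I) (eps i - eps j) (eps j - eps k) = -1.
Proof.
move=> ij ki kj; rewrite /cartan (norm_rootD (rootA_rootD (rootA_eps _)))
  1?eq_sym//.
have -> : eps i - eps j = 1 *: eps i + (-1) *: eps j by rewrite scale1r scaleN1r.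
rewrite dot2 !coordE !eqxx (eq_sym j i) (negPf ij) (negPf ki) (negPf kj).
by [].
Qed.

Lemma obtuse_rootA : (`I_3 #<= [set: I])%card -> exists u v,
  [/\ rootA I u, rootA I v & cartan (dot I) u v = -1].
Proof.
move=> /card_geP[s [+ ss]]; case: s ss => [|i [|j [|k []]]] //= _;
  rewrite !inE negb_or andbT.
case/andP=> /andP[ij ik] jk.
exists (eps i - eps j), (eps j - eps k); split;
  [exact: rootA_eps|exact: rootA_eps|].
by apply: obtuse_eps => //; rewrite eq_sym.
Qed.

(** Roots on coordinate axes are proportional or orthogonal. *)
Lemma not_obtuse_axis k i j (a b : bool) : k != 0 ->
  cartan (dot I) (sign a *: (k *: eps i)) (sign b *: (k *: eps j)) != -1.
Proof.
move=> k0; rewrite !scalerA /cartan norm_eps dot1 !coordE !signE.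
have e : forall s t : rat, s * s = 1 -> t * t = 1 -> forall d : bool,
    2 * (s * k * (t * k * d%:R)) / (t * k * (t * k)) = 2 * s * t * d%:R.
  move=> s t ss tt d.
  transitivity (2 * (s * t * d%:R) * (k * k) / (t * t * (k * k)));
    first by congr (_ / _); ring.
  by rewrite tt; field.
rewrite e; first by case: a; case: b; case: (j == i).
  by case: a.
by case: b.
Qed.

Lemma two_indices : (`I_2 #<= [set: I])%card -> exists i j, i != j.
Proof.
by move=> /card_geP[s [+ ss]]; case: s ss => [|i [|j []]] //= _;
  rewrite inE andbT => ij; exists i, j.
Qed.

Lemma profile_A : (`I_2 #<= [set: I])%card -> coordinate_profile (rootA I) 2 None
  false
  (exists u v, [/\ rootA I u, rootA I v & cartan (dot I) u v = -1]) False.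
Proof.
move=> /two_indices[i [j ij]]; split=> //.
- by move=> u /rootA_rootD/finite_support_rootD.
- by move=> u /rootA_rootD/norm_rootD; apply: Or31.
- by exists (eps i - eps j);
  [exact: rootA_eps|apply/norm_rootD/rootA_rootD/rootA_eps].
- split=> [[u [v [[Au _] [Av _] uv]]]|[u [v [Au Av uv]]]]; exists u, v => //.
  by split=> //; split=> //; apply/norm_rootD/rootA_rootD.
Qed.

Lemma profile_D : (`I_4 #<= [set: I])%card ->
  coordinate_profile (rootD I) 2 None false True False.
Proof.
move=> c4; have c3 : (`I_3 #<= [set: I])%card.
  by apply: (card_le_trans _ c4); rewrite card_le_II.
have [u [v [Au Av uv]]] := obtuse_rootA c3.
have [Du Dv] := (rootA_rootD Au, rootA_rootD Av).
split=> //.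
- by move=> w /finite_support_rootD.
- by move=> w /norm_rootD; apply: Or31.
- by exists u => //; exact: norm_rootD.
- by split=> // _; exists u, v; split=> //; split=> //; exact: norm_rootD.
Qed.

Lemma finite_support_axis k i (a : bool) : finite_support (sign a *: (k *: eps i)).
Proof. by do 2 apply: finite_supportZ; exact: finite_support_eps. Qed.

Lemma norm_axis k i (a : bool) : N (sign a *: (k *: eps i)) = k * k.
Proof. by rewrite scalerA norm_eps signE; case: a; ring. Qed.

Definition axis k : set (I -> rat^o) :=
  [set x : I -> rat^o | exists i a, x = sign a *: (k *: eps i)].

Lemma rootBE : rootB I = axis 1 `|` rootD I.
Proof.
rewrite /rootB; congr (_ `|` _); apply/seteqP; split=> u [i [a ->]];
  by exists i, a; rewrite scale1r.
Qed.

Lemma rootCE : Defs.rootC I = axis 2 `|` rootD I. Proof. by []. Qed.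

Lemma rootBCE : rootBC I = axis 1 `|` axis 2 `|` rootD I.
Proof. by rewrite /rootBC rootBE rootCE setUACA setUid. Qed.

Lemma rootD_neq0 : (`I_2 #<= [set: I])%card -> exists u, rootD I u.
Proof.
by move=> /two_indices[i [j ij]]; exists (eps i - eps j);
  apply/rootA_rootD/rootA_eps.
Qed.

Lemma axis_neq0 k : (`I_2 #<= [set: I])%card -> exists u, axis k u.
Proof. by move=> /two_indices[i _]; exists (sign false *: (k *: eps i));
  exists i, false. Qed.

Lemma norm_axisE k u : axis k u -> N u = k * k.
Proof. by move=> [i [a ->]]; exact: norm_axis. Qed.

Lemma axis_support k u : axis k u -> finite_support u.
Proof. by move=> [i [a ->]]; exact: finite_support_axis. Qed.

Lemma axis_not_obtuse k u v : k != 0 -> axis k u -> axis k v ->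
  cartan (dot I) u v <> -1.
Proof. by move=> k0 [i [a ->]] [j [b ->]]; apply/eqP; exact: not_obtuse_axis. Qed.

Lemma obtuse_rootDP : (exists u v, [/\ rootD I u, rootD I v
  & cartan (dot I) u v = -1])
  <-> (`I_3 #<= [set: I])%card.
Proof.
split=> [[u [v [Du Dv uv]]]|/obtuse_rootA[u [v [Au Av uv]]]];
  first exact: obtuse_rootD uv.
by exists u, v; split=> //; exact: rootA_rootD.
Qed.

Lemma profile_B : (`I_2 #<= [set: I])%card ->
  coordinate_profile (rootB I) 1 (Some 2) false False (`I_3 #<= [set: I])%card.
Proof.
move=> c2; have [d Dd] := rootD_neq0 c2; have [e Ae] := axis_neq0 1 c2.
have sh u : rootB I u -> N u = 1 -> axis 1 u.
  by rewrite rootBE => -[//|/norm_rootD ->].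
have lg u : rootB I u -> N u = 2 * 1 -> rootD I u.
  by rewrite rootBE => -[/norm_axisE ->|//].
split=> //.
- by rewrite rootBE => u [/axis_support|/finite_support_rootD].
- by left.
- by rewrite rootBE => u [/norm_axisE|/norm_rootD] ->; [apply: Or31|apply: Or32].
- by exists e; [rewrite rootBE; left|rewrite (norm_axisE Ae)].
- by exists d; [rewrite rootBE; right|rewrite (norm_rootD Dd)].
- split=> // -[u [v [[/sh h /h{h} Au] [/sh h /h{h} Av]]]].
  exact: (axis_not_obtuse _ Au Av).
- rewrite -obtuse_rootDP; split=> -[u [v [h1 h2 uv]]]; exists u, v.
    by case: h1 h2 => /lg h /h Du [/lg h' /h' Dv].
  by rewrite (norm_rootD h1) (norm_rootD h2) rootBE; split=> //; split=> //; right.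
Qed.

Lemma profile_C : (`I_2 #<= [set: I])%card ->
  coordinate_profile (Defs.rootC I) 2 (Some 2) false (`I_3 #<= [set: I])%card False.
Proof.
move=> c2; have [d Dd] := rootD_neq0 c2; have [e Ae] := axis_neq0 2 c2.
have sh u : Defs.rootC I u -> N u = 2 -> rootD I u.
  by rewrite rootCE => -[/norm_axisE ->|//].
have lg u : Defs.rootC I u -> N u = 2 * 2 -> axis 2 u.
  by rewrite rootCE => -[//|/norm_rootD ->].
split=> //.
- by rewrite rootCE => u [/axis_support|/finite_support_rootD].
- by left.
- by rewrite rootCE => u [/norm_axisE|/norm_rootD] ->; [apply: Or32|apply: Or31].
- by exists d; [rewrite rootCE; right|rewrite (norm_rootD Dd)].
- by exists e; [rewrite rootCE; left|rewrite (norm_axisE Ae)].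
- rewrite -obtuse_rootDP; split=> -[u [v [h1 h2 uv]]]; exists u, v.
    by case: h1 h2 => /sh h /h Du [/sh h' /h' Dv].
  by rewrite (norm_rootD h1) (norm_rootD h2) rootCE; split=> //; split=> //; right.
- split=> // -[u [v [[/lg h /h{h} Au] [/lg h /h{h} Av]]]].
  exact: (axis_not_obtuse _ Au Av).
Qed.

Lemma profile_BC : (`I_2 #<= [set: I])%card ->
  coordinate_profile (rootBC I) 1 (Some 2) true False (`I_3 #<= [set: I])%card.
Proof.
move=> c2; have [d Dd] := rootD_neq0 c2; have [e Ae] := axis_neq0 1 c2.
have [g Ag] := axis_neq0 2 c2.
have sh u : rootBC I u -> N u = 1 -> axis 1 u.
  by rewrite rootBCE => -[[//|/norm_axisE ->]|/norm_rootD ->].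
have lg u : rootBC I u -> N u = 2 * 1 -> rootD I u.
  by rewrite rootBCE => -[[/norm_axisE ->|/norm_axisE ->]|//].
split=> //.
- by rewrite rootBCE => u [[/axis_support|/axis_support]|/finite_support_rootD].
- by left.
- by rewrite rootBCE => u [[/norm_axisE|/norm_axisE]|/norm_rootD] ->;
    [apply: Or31|apply: Or33|apply: Or32].
- by exists e; [rewrite rootBCE; left; left|rewrite (norm_axisE Ae)].
- by exists d; [rewrite rootBCE; right|rewrite (norm_rootD Dd)].
- by exists g; [rewrite rootBCE; left; right|rewrite (norm_axisE Ag)].
- split=> // -[u [v [[/sh h /h{h} Au] [/sh h /h{h} Av]]]].
  exact: (axis_not_obtuse _ Au Av).
- rewrite -obtuse_rootDP; split=> -[u [v [h1 h2 uv]]]; exists u, v.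
    by case: h1 h2 => /lg h /h Du [/lg h' /h' Dv].
  by rewrite (norm_rootD h1) (norm_rootD h2) rootBCE; split=> //; split=> //; right.
Qed.

End Coordinates.

Lemma profile_BC1 : coordinate_profile (rootBC 'I_1) 1 None true False False.
Proof.
have noD u : ~ rootD 'I_1 u by move=> [i [j [a [b [ij _]]]]]; rewrite !ord1 in ij.
have ax k : @axis 'I_1 k (sign false *: (k *: eps ord0)) by exists ord0, false.
split=> //.
- by rewrite rootBCE => u [[/axis_support|/axis_support]|/finite_support_rootD].
- by rewrite rootBCE => u [[/norm_axisE|/norm_axisE]|/noD//] ->;
  [apply: Or31|apply: Or33].
- by exists (sign false *: (1 *: eps ord0)); [rewrite rootBCE; left;
  left|rewrite (norm_axisE (ax 1))].
- by exists (sign false *: (2 *: eps ord0)); [rewrite rootBCE; left;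
  right|rewrite (norm_axisE (ax 2))].
- have sh u : rootBC 'I_1 u -> dot 'I_1 u u = 1 -> @axis 'I_1 1 u.
    by rewrite rootBCE => -[[//|/norm_axisE ->]|/noD].
  split=> // -[u [v [[/sh h /h{h} Au] [/sh h /h{h} Av]]]].
  exact: (axis_not_obtuse _ Au Av).
Qed.

Lemma finite_support_ord n (u : 'I_n -> rat^o) : finite_support u.
Proof. by exists (enum 'I_n) => i _; rewrite mem_enum. Qed.

Lemma norm_half n (a : 'I_n -> bool) : dot 'I_n (half_vector a) (half_vector a) =
  n%:R / 4.
Proof.
rewrite dot_ord (eq_bigr (fun=> 4^-1)); last first.
  by move=> i _; apply/eqP; rewrite /half_vector signE; case: (a i).
by rewrite sumr_const card_ord [RHS]mulr_natl.
Qed.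

(** The roots of E8 have norm 2, and e0 - e1, e1 - e2 is an obtuse pair that
    survives in E7 and E6. *)
Lemma profile_sub_E8 (Std : set ('I_8 -> rat^o)) : Std `<=` rootE8 ->
  Std (eps (inord 0) - eps (inord 1)) -> Std (eps (inord 1) - eps (inord 2)) ->
  coordinate_profile Std 2 None false True False.
Proof.
move=> sub S01 S12.
have nrm u : Std u -> dot 'I_8 u u = 2.
  by move=> /sub[/norm_rootD//|[a _ ->]]; rewrite norm_half.
have ne (i j : nat) : (i < 8)%N -> (j < 8)%N -> i != j -> inord i != inord j :>
  'I_8.
  by move=> hi hj; apply: contra => /eqP/(congr1 val); rewrite /= !inordK// => ->.
split=> //.
- by move=> u _; exact: finite_support_ord.
- by move=> u /nrm; apply: Or31.
- by exists (eps (inord 0) - eps (inord 1)); rewrite ?nrm.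
- split=> // _; exists (eps (inord 0) - eps (inord 1)),
  (eps (inord 1) - eps (inord 2)).
  by split; [rewrite nrm|rewrite nrm|apply: obtuse_eps; exact: ne].
Qed.

Lemma profile_E8 : coordinate_profile rootE8 2 None false True False.
Proof.
by apply: profile_sub_E8 => //; left; apply: rootA_rootD; apply: rootA_eps;
  apply/eqP => /(congr1 val); rewrite /= !inordK.
Qed.

Lemma eps_inord8 i j : (i < 8)%N -> (j < 8)%N ->
  eps (inord i : 'I_8) (inord j) = (i == j)%:R.
Proof.
move=> hi hj; rewrite epsE; congr (_%:R); congr nat_of_bool.
by apply/eqP/eqP => [/(congr1 val)|->//]; rewrite /= !inordK.
Qed.

Lemma rootA_E8 i j : (i < 8)%N -> (j < 8)%N -> i != j ->
  rootE8 (eps (inord i) - eps (inord j)).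
Proof.
move=> hi hj ij; left; apply: rootA_rootD; apply: rootA_eps.
by apply: contra ij => /eqP/(congr1 val); rewrite /= !inordK// => ->.
Qed.

Lemma profile_E7 : coordinate_profile rootE7 2 None false True False.
Proof.
by apply: profile_sub_E8 => [u []//||]; split; (try exact: rootA_E8);
  rewrite !(fctD, fctN) !eps_inord8.
Qed.

Lemma profile_E6 : coordinate_profile rootE6 2 None false True False.
Proof.
by apply: profile_sub_E8 => [u [[]]//||]; (split; [split|]); (try exact: rootA_E8);
  rewrite !(fctD, fctN) !eps_inord8.
Qed.

Lemma profile_F4 : coordinate_profile rootF4 1 (Some 2) false True True.
Proof.
have c2 : (`I_2 #<= [set: 'I_4])%card.
  by apply/card_geP; exists [:: ord0; Ordinal (isT : 1 < 4)%N].
have c3 : (`I_3 #<= [set: 'I_4])%card.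
  by apply/card_geP; exists [:: ord0; Ordinal (isT : 1 < 4)%N;
    Ordinal (isT : 2 < 4)%N].
have [_ _ _ nB shB lgB _ _ oB] := profile_B c2.
have half (a : 'I_4 -> bool) : dot 'I_4 (half_vector a) (half_vector a) = 1
  by rewrite norm_half.
split=> //.
- by move=> u _; exact: finite_support_ord.
- by left.
- by move=> u [/nB//|[a ->]]; rewrite half; apply: Or31.
- by have [u Bu nu] := shB; exists u => //; left.
- by have [u Bu nu] := lgB; exists u => //; left.
(* - e0 and (1/2, 1/2, 1/2, 1/2) *)
- split=> // _; exists (- 1 *: eps ord0), (half_vector (fun=> false)).
  split; first by split; [left; left; exists ord0, true|rewrite norm_eps].
    by rewrite half; split=> //; right; exists (fun=> false).
  by rewrite /cartan half dot1 /half_vector signE.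
- split=> // _; have [u [v [[Bu nu] [Bv nv] uv]]] := proj2 oB c3.
  by exists u, v; split=> //; split=> //; left.
Qed.

Lemma profile_G2 : coordinate_profile rootG2 2 (Some 3) false True True.
Proof.
have c3 : (`I_3 #<= [set: 'I_3])%card.
  by apply/card_geP; exists (enum 'I_3); rewrite enum_uniq size_enum_ord.
have dot3 (s : rat) (i j k : 'I_3) y :
    dot 'I_3 (s *: (2 *: eps i - eps j - eps k)) y = s * (2 * y i - y j - y k).
  have -> : 2 *: eps i - eps j - eps k = (2 *: eps i + (-1) *: eps j) + (-1) *:
    eps k.
    by rewrite !scaleN1r.
  rewrite dotZl; last exact: finite_support_ord.
  by rewrite dotDl ?dot2 ?dot1;
    [ring|exact: finite_support_ord|exact: finite_support_ord].
have nlong (s : bool) (i j k : 'I_3) : uniq [:: i; j; k] -> let x :=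
    sign s *: (2 *: eps i - eps j - eps k) in dot 'I_3 x x = 6.
  rewrite /= !inE negb_or andbT => /andP[/andP[ij ik] jk].
  rewrite dot3 !coordE !eqxx (eq_sym j i) (eq_sym k i) (eq_sym k j).
  by rewrite (negPf ij) (negPf ik) (negPf jk) signE; case: s.
pose i0 := ord0 : 'I_3; pose i1 := Ordinal (isT : 1 < 3)%N;
  pose i2 := Ordinal (isT : 2 < 3)%N.
pose u := sign false *: (2 *: eps i0 - eps i1 - eps i2).
pose v := sign false *: (2 *: eps i1 - eps i0 - eps i2).
split=> //.
- by move=> w _; exact: finite_support_ord.
- by right.
- move=> w [/rootA_rootD/norm_rootD|[i [j [k [s [ijk ->]]]]]]; first by apply: Or31.
  by apply: Or32; rewrite nlong.
- have [w [_ [Aw _ _]]] := obtuse_rootA c3; exists w; first by left.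
  exact/norm_rootD/rootA_rootD.
- by exists u; [right; exists i0, i1, i2, false|rewrite nlong].
- split=> // _; have [w [z [Aw Az wz]]] := obtuse_rootA c3; exists w, z.
  by split=> //; (split; [left|exact/norm_rootD/rootA_rootD]).
- split=> // _; exists u, v; split.
  + by split; [right; exists i0, i1, i2, false|rewrite nlong].
  + by split; [right; exists i1, i0, i2, false|rewrite nlong].
  + by rewrite /cartan nlong// dot3 /v !coordE.
Qed.

(** * Systems without obtuse pairs *)

Lemma ord2_card : ~ (`I_3 #<= [set: 'I_2])%card.
Proof.
move=> /card_geP[s [us ss]]; have /card_uniqP us3 := us.
by have := max_card (mem s); rewrite us3 ss card_ord.
Qed.

Section RankOne.
Variables (V : lmodType rat) (form : {symmetric V}).

(** The linear map that is zero on the orthogonal of a and sends a to the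
    root e0 - e1 of A1. *)
Definition line_coordinate (a v : V) : 'I_2 -> rat^o :=
  (form v a / form a a) *: (eps (ord0 : 'I_2) - eps (ord_max : 'I_2)).

Lemma line_coordinate_linear a : linear (line_coordinate a).
Proof.
move=> k u v; rewrite /line_coordinate formDl formZl mulrDl -mulrA scalerDl.
by rewrite -[in LHS]scalerA.
Qed.

Variables (W Delta : set V).
Hypothesis rsys : is_lf_irr_root_system form W Delta.

(** When all roots have the same norm and none form an obtuse pair, two roots
    are equal up to sign or orthogonal. So the set of a and - a is stable
    under reflections, and irreducibility makes it all of Delta. *)
Lemma rank_one_iso : long_roots form Delta = set0 ->
  extra_long_roots form Delta = set0 ->
  ~ has_obtuse_pair form (short_roots form Delta) ->
  root_iso form Delta (dot 'I_2) (rootA 'I_2).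
Proof.
move=> lg0 ex0 nobt; have [a sa] := short_root_exists rsys.
have [Da _] := sa; have a0 := root_norm_neq0 rsys Da.
have allsh b : Delta b -> short_roots form Delta b.
  move=> Db; have [//|lb|xb] := root_class form Db.
    by suff : set0 b by []; rewrite -lg0.
  by suff : set0 b by []; rewrite -ex0.
have cart b c : Delta b -> Delta c ->
    [\/ cartan form c b = 0, b = c | b = - c].
  move=> Db Dc; have e := short_norm (allsh _ Db) (allsh _ Dc).
  have DshN d : short_roots form Delta d -> short_roots form Delta (- d).
    by move=> [Dd _]; apply: allsh; exact: (root_opp rsys Dd).
  have [h|[_ h]|[_ h]|[/nobt//]] :=
    equal_norm_cartan rsys (@short_root _ form Delta) DshN (allsh _ Db) (allsh _
      Dc) e;
  by [apply: Or31|apply: Or32|apply: Or33].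
have line b : Delta b -> b = a \/ b = - a.
  have Pinv c d : Delta c -> Delta d -> d = a \/ d = - a ->
      reflection form c d = a \/ reflection form c d = - a.
    move=> Dc Dd hd; have [h|h|h] := cart _ _ Dc Dd.
    - by rewrite /reflection h scale0r subr0.
    - rewrite h reflection_self ?(root_norm_neq0 rsys)//.
      by case: hd => ->; [right|left; rewrite opprK].
    - rewrite h reflectionN reflection_self ?(root_norm_neq0 rsys)//.
      by case: hd => ->; [right|left; rewrite opprK].
  move=> Db; have [c [Dc hc cb]] := invariant_meets rsys (P :=
    fun c => c = a \/ c = - a)
    Pinv Da (or_introl erefl) Db.
  have [h|<-|e] := cart _ _ Dc Db; [|by []|].
    have := cartanK b (root_norm_neq0 rsys Dc); rewrite h mul0r formC => /esym/eqP.
    by rewrite mulf_eq0 (negPf cb).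
  by move: e => /(congr1 -%R); rewrite opprK => <-; case: hc => ->; [right|left;
    rewrite opprK].
have spanE v : lin_span Delta v -> exists k, v = k *: a.
  apply: (@lin_span_sub _ _ [set v | exists k, v = k *: a]) => [|b /line[->|->]].
  - split=> [|_ _ [k ->] [l ->]|k _ [l ->]]; first by exists 0; rewrite scale0r.
      by exists (k + l); rewrite scalerDl.
    by exists (k * l); rewrite scalerA.
  - by exists 1; rewrite scale1r.
  - by exists (-1); rewrite scaleN1r.
pose e0 := eps (ord0 : 'I_2); pose e1 := eps (ord_max : 'I_2).
pose lin := GRing.isLinear.Build rat V ('I_2 -> rat^o) *:%R (line_coordinate a)
  (line_coordinate_linear a).
pose f : {linear V -> ('I_2 -> rat^o)} := HB.pack (line_coordinate a) lin.
have fZ k : line_coordinate a (k *: a) = k *: (e0 - e1).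
  by rewrite /line_coordinate formZl mulfK.
have fa : line_coordinate a a = e0 - e1
  by rewrite -[X in line_coordinate _ X]scale1r fZ scale1r.
have fNa : line_coordinate a (- a) = - (e0 - e1) by rewrite -scaleN1r fZ scaleN1r.
have D01 : rootD 'I_2 (e0 - e1) by apply/rootA_rootD/rootA_eps.
have cartD : cartan (dot 'I_2) (e0 - e1) (e0 - e1) = 2.
  by rewrite /cartan (norm_rootD D01).
exists f; split.
- move=> u v /set_mem/spanE[k ->] /set_mem/spanE[l ->] /=; rewrite !fZ.
  move=> /(congr1 (fun x : 'I_2 -> rat^o => x ord0)); rewrite !coordE /=.
  by rewrite subr0 !mulr1 => ->.
- apply/seteqP; split=> [_ [b /line[->|->] <-]|_ [i [j [ij ->]]]] /=.
  + by rewrite fa; exists ord0, ord_max.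
  + by rewrite fNa opprB; exists ord_max, ord0.
  + have [i0|i1] : i = ord0 \/ i = ord_max.
      by case: i {ij} => [[|[|//]] hi]; [left|right]; apply: val_inj.
    * exists a => //; rewrite fa i0; congr (_ - eps _); move: ij; rewrite i0.
      by case: j => [[|[|//]] hj] // _; apply: val_inj.
    * exists (- a); first exact: (root_opp rsys Da).
      rewrite fNa opprB i1; congr (_ - eps _); move: ij; rewrite i1.
      by case: j => [[|[|//]] hj] // _; apply: val_inj.
- move=> b c /line hb /line hc /=.
  have sgn x : x = a \/ x = - a -> exists s : bool, x = sign s *: a.
    by case=> ->; [exists false|exists true]; rewrite signE ?scale1r ?scaleN1r.
  have [[s ->] [t ->]] := (sgn _ hb, sgn _ hc); rewrite !fZ /cartan !formE.
  have fin (u : 'I_2 -> rat^o) : finite_support u := finite_support_ord u.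
  rewrite !(dotZl, dotZr)// (norm_rootD D01) !signE.
  by case: s; case: t; field.
Qed.
End RankOne.

(** * Pieces of a decomposition and reflection spaces *)

Section Sumsets.
Variable V : lmodType rat.
Implicit Types A B C : set V.

Lemma sumset_subP A B C :
  sumset A B `<=` C <-> forall x y, A x -> B y -> C (x + y).
Proof.
split=> [h x y Ax By|h _ [x Ax [y By <-]]]; last exact: h.
by apply: h; exists x => //; exists y.
Qed.

Lemma sumset_dilate_subP k A B C :
  sumset (dilate k A) B `<=` C <-> forall x y, A x -> B y -> C (k *: x + y).
Proof.
rewrite sumset_subP; split=> [h x y Ax By|h _ y [x Ax <-] By]; last exact: h.
by apply: h => //; exists x.
Qed.

Lemma reflection_spaceP W A : reflection_space W A <->
  A `<=` W /\ forall x y, A x -> A y -> A (x - 2 *: y).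
Proof.
rewrite /reflection_space sumset_subP; split=> -[AW h]; split=> // x y Ax.
  by move=> Ay; rewrite -scaleNr; apply: h => //; exists y.
by move=> [z Az <-]; rewrite scaleNr; exact: h.
Qed.

Lemma reflection_space_subgroup A : A 0 ->
  (forall x y, A x -> A y -> A (x - 2 *: y)) ->
  (forall x y, A x -> A y -> A (x + y)) -> subgroup A.
Proof.
by move=> A0 A2 AD; split=> // x y Ax Ay; apply: AD => //; exact: reflection_spaceN.
Qed.

Lemma sumset0 A : sumset set0 A = set0.
Proof. by apply/seteqP; split=> // _ [x []]. Qed.

Lemma subgroup_scale A (k : nat) x : subgroup A -> A x -> A (k%:R *: x).
Proof.
move=> sA Ax; elim: k => [|k IHk]; first by rewrite scale0r; case: sA.
by rewrite -natr1 scalerDl scale1r; exact: subgroupD.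
Qed.

Lemma subgroup_reflection A : subgroup A -> forall x y,
  A x -> A y -> A (x - 2 *: y).
Proof.
by move=> sA x y Ax Ay; case: (sA) => _; apply=> //; exact: (subgroup_scale 2).
Qed.

End Sumsets.

Section Unions.
Variable T : Type.
Implicit Types A B C : set T.

Lemma union_of1 A : union_of [:: A] = A.
Proof. by apply/seteqP; split=> [x [[|i] //]|x Ax]; exists 0%N. Qed.

Lemma union_of2 A B : union_of [:: A; B] = A `|` B.
Proof.
apply/seteqP; split=> [x [[|[|i]] //= _ h]|x [h|h]]; [by left|by right| |].
  by exists 0%N.
by exists 1%N.
Qed.

Lemma union_of3 A B C : union_of [:: A; B; C] = A `|` B `|` C.
Proof.
apply/seteqP; split=> [x [[|[|[|i]]] //= _ h]|x [[h|h]|h]];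
  [by left; left|by left; right|by right| | |].
- by exists 0%N.
- by exists 1%N.
- by exists 2%N.
Qed.

Lemma pairwise_disjoint1 A : pairwise_disjoint [:: A].
Proof. by move=> [|i] [|j]. Qed.

Lemma pairwise_disjoint2 A B : A `&` B = set0 -> pairwise_disjoint [:: A; B].
Proof.
move=> AB [|[|i]] [|[|j]] //= _ _ [x [h1 h2]]; suff : set0 x by [].
  by rewrite -AB.
by rewrite -AB.
Qed.

Lemma pairwise_disjoint3 A B C : A `&` B = set0 -> A `&` C = set0 -> B `&` C =
  set0 ->
  pairwise_disjoint [:: A; B; C].
Proof.
move=> AB AC BC [|[|[|i]]] [|[|[|j]]] //= _ _ [x [h1 h2]]; suff : set0 x by [].
- by rewrite -AB.
- by rewrite -AC.
- by rewrite -AB.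
- by rewrite -BC.
- by rewrite -AC.
- by rewrite -BC.
Qed.

End Unions.

(** * The conditions of each type as systems of shifts *)

Definition long_ratio (t : root_type) : option rat :=
  match t with
  | TypeB _ | TypeC _ | TypeBC _ | TypeF4 => Some 2
  | TypeG2 => Some 3
  | _ => None
  end.

(** In type A the condition is kept in coordinates: there, excluding obtuse
    pairs amounts to Delta being A1, by [A1_not_obtuse] and
    [rank_one_iso]. *)
Definition obtuse_short (t : root_type) : Prop :=
  match t with
  | TypeA J => exists u v, [/\ rootA J u, rootA J v & cartan (dot J) u v = -1]
  | TypeC J => (`I_3 #<= [set: J])%card
  | TypeD _ | TypeE6 | TypeE7 | TypeE8 | TypeF4 | TypeG2 => True
  | _ => False
  end.

Definition obtuse_long (t : root_type) : Prop :=
  match t with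
  | TypeB J | TypeBC J => (`I_3 #<= [set: J])%card
  | TypeF4 | TypeG2 => True
  | _ => False
  end.

Lemma standard_profile t : rank_condition t ->
  exists m, coordinate_profile (@standard t) m (long_ratio t) (is_BC t)
    (obtuse_short t) (obtuse_long t).
Proof.
case: t => [J|J|J|J||||J|||] /= hr.
- by exists 2; exact: profile_A.
- by exists 1; exact: profile_B.
- by exists 2; exact: profile_C.
- by exists 2; exact: profile_D.
- by exists 2; exact: profile_E6.
- by exists 2; exact: profile_E7.
- by exists 2; exact: profile_E8.
- by exists 1; exact: profile_BC.
- by exists 1; exact: profile_BC1.
- by exists 1; exact: profile_F4.
- by exists 2; exact: profile_G2.
Qed.

Section Types.
Variables (V : lmodType rat) (form : {symmetric V}) (W Delta : set V).
Hypothesis rsys : is_lf_irr_root_system form W Delta.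
Local Notation V0 := (radical form).
Local Notation sh := (short_roots form Delta).
Local Notation lg := (long_roots form Delta).
Local Notation ex := (extra_long_roots form Delta).

Lemma type_profile t : is_of_type form Delta t ->
  profile form Delta (long_ratio t) (is_BC t) (obtuse_short t) (obtuse_long t).
Proof.
move=> [hr iso]; have [m prof] := standard_profile hr.
exact: profile_transfer rsys iso prof.
Qed.

Lemma A1_not_obtuse : root_iso form Delta (dot 'I_2) (rootA 'I_2) ->
  ~ has_obtuse_pair form sh.
Proof.
have c2 : (`I_2 #<= [set: 'I_2])%card.
  by apply/card_geP; exists (enum 'I_2); rewrite enum_uniq size_enum_ord.
move=> iso; have [_ _ [h _] _] := profile_transfer rsys iso (profile_A c2).
move=> /h[u [v [Au Av uv]]]; apply: ord2_card.
exact: obtuse_rootD (rootA_rootD Au) (rootA_rootD Av) uv.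
Qed.

Variables (S L E : set V).
Local Notation T := (class_shift form Delta S L E).

Lemma all_roots_short : lg = set0 -> ex = set0 -> Delta = sh.
Proof.
move=> lg0 ex0; apply/seteqP; split=> [a Da|a []//].
have [//|h|h] := root_class form Da; suff : set0 a by [].
  by rewrite -lg0.
by rewrite -ex0.
Qed.

Lemma shifted_rootsE :
  shifted_roots Delta T = sumset sh S `|` sumset lg L `|` sumset ex E.
Proof.
apply/seteqP; split=> [_ [a [s [Da hs ->]]]|_ [[[a sa [s Ss <-]]|
  [a la [s Ls <-]]]|[a xa [s Es <-]]]].
- by case: hs => -[ha hs]; [left; left|left; right|right]; exists a => //; exists s.
- by exists a, s; split=> //; [exact: (short_root sa)|exact: Or31].
- by exists a, s; split=> //; [exact: (long_root la)|exact: Or32].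
- by exists a, s; split=> //; [exact: (extra_root xa)|exact: Or33].
Qed.

Lemma pieces_union t : is_of_type form Delta t ->
  union_of (type_pieces form t Delta S L E S) = shifted_roots Delta T.
Proof.
move=> /type_profile[hlg hex _ _]; rewrite shifted_rootsE.
have none : long_ratio t = None -> sumset lg L = set0.
  by case: (long_ratio t) hlg => // -> _; rewrite sumset0.
have noex : is_BC t = false -> sumset ex E = set0.
  by case: (is_BC t) hex => // -> _; rewrite sumset0.
have all : long_ratio t = None -> is_BC t = false -> sumset Delta S = sumset sh S.
  by move=> h1 h2; rewrite h1 h2 in hlg hex; rewrite -all_roots_short.
case: t none noex all {hlg hex} => [J|J|J|J||||J|||] /= none noex all;
  first [ by rewrite union_of1 all// none// noex// !setU0
        | by rewrite union_of2 noex// setU0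
        | by rewrite union_of2 none// setU0
        | by rewrite union_of3 ].
Qed.

Lemma pieces_disjoint t : direct_sum W V0 -> S `<=` V0 ->
  (lg !=set0 -> L `<=` V0) -> (ex !=set0 -> E `<=` V0) ->
  pairwise_disjoint (type_pieces form t Delta S L E S).
Proof.
move=> dW SV LV EV; have sW := root_span_subspace rsys.
have disj (C C' : set V) X Y : C `<=` Delta -> C' `<=` Delta -> (forall a,
  ~ (C a /\ C' a)) ->
    (C !=set0 -> X `<=` V0) -> (C' !=set0 -> Y `<=` V0) -> sumset C X `&` sumset
      C' Y = set0.
  move=> CD C'D CC' XV YV; apply/seteqP;
    split=> // _ [[a Ca [s Xs <-]] [b Cb [t' Yt e]]].
  have Wa := root_in_span rsys (CD _ Ca); have Wb := root_in_span rsys (C'D _ Cb).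
  have Vs : V0 s by apply: XV Xs; exists a.
  have Vt : V0 t' by apply: YV Yt; exists b.
  have [ba _] := direct_sum_inj sW dW Wb Wa Vt Vs e.
  by apply: (CC' a); split=> //; rewrite -ba.
have shlg : sumset sh S `&` sumset lg L = set0.
  by apply: disj => //; [exact: short_root|exact: long_root|move=> a;
    case: (class_disjoint rsys a)].
have shex : sumset sh S `&` sumset ex E = set0.
  by apply: disj => //; [exact: short_root|exact: extra_root|move=> a;
    case: (class_disjoint rsys a)].
have lgex : sumset lg L `&` sumset ex E = set0.
  by apply: disj => //; [exact: long_root|exact: extra_root|move=> a;
    case: (class_disjoint rsys a)].
by case: t => [J|J|J|J||||J|||] /=; (try exact: pairwise_disjoint1);
  (try exact: pairwise_disjoint2); exact: pairwise_disjoint3.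
Qed.

(** G occurs in the pieces of the types in which S = G only. *)
Lemma type_pieces_G t G : type_conditions form t Delta S L E G ->
  type_pieces form t Delta S L E G = type_pieces form t Delta S L E S.
Proof. by case: t => [J|J|J|J||||J|||] //=; [move=> ->..|case=> ->|case=> ->]. Qed.

(** Obtuse pairs make a class closed under addition, so that its shifts form
    a group; this is where |I| > 2 enters, through [type_profile]. *)
Lemma system_type_conditions t G : is_of_type form Delta t ->
  S `<=` V0 -> (lg !=set0 -> L `<=` V0) -> (ex !=set0 -> E `<=` V0) ->
  (lg !=set0 -> L 0) -> generated S = G ->
  shift_system form Delta S L E -> type_conditions form t Delta S L E G.
Proof.
move=> tD SV LV EV L0 <- [S0 S2 L2 E2 SL LS SE ES LE EL SS LL].
have [hlg hex hsh hol] := type_profile tD.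
have [a sa] := short_root_exists rsys.
have SG : has_obtuse_pair form sh -> S = generated S.
  move=> /SS SD; rewrite /generated smallest_id//; exact: reflection_space_subgroup.
have Lgrp : lg !=set0 -> has_obtuse_pair form lg -> subgroup L.
  by move=> l0 /LL LD; apply: reflection_space_subgroup; auto.
have pS : pointed_reflection_space V0 S by split=> //; apply/reflection_spaceP.
have pL : lg !=set0 -> pointed_reflection_space V0 L.
  by move=> l0; split; [apply/reflection_spaceP; auto|exact: L0].
have pE : ex !=set0 -> reflection_space V0 E.
  by move=> e0; apply/reflection_spaceP; auto.
have kL c : lg !=set0 -> (forall a b, sh a -> lg b -> form b b = c * form a a) ->
    sumset (dilate c S) L `<=` L /\ sumset S L `<=` S.
  move=> l0 hc; rewrite sumset_dilate_subP sumset_subP; split; last exact: SL.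
  by have [b lb] := l0; exact: (LS a b c sa lb (hc _ _ sa lb)).
case: t tD hlg hex hsh hol => [J|J|J|J||||J|||] tD /= hlg hex hsh hol.
- split=> // nA1; apply: SG; apply: contrapT => nobt; apply: nA1.
  exact: rank_one_iso rsys hlg hex nobt.
- have [l0 hc] := hlg; have [h1 h2] := kL _ l0 hc; split; auto.
  by move=> c3; apply: Lgrp => //; apply/hol.
- have [l0 hc] := hlg; have [h1 h2] := kL _ l0 hc; split; auto.
  by move=> c3; apply: SG; apply/hsh.
- by apply: SG; apply/hsh.
- by apply: SG; apply/hsh.
- by apply: SG; apply/hsh.
- by apply: SG; apply/hsh.
- have [l0 hc] := hlg; have [h1 h2] := kL _ l0 hc.
  split; [by split; auto|by []| | |by move=> c3; apply: Lgrp => //; apply/hol].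
    by split; [apply/sumset_dilate_subP; exact: ES|apply/sumset_subP; exact: SE].
  by split; [apply/sumset_dilate_subP; exact: EL|apply/sumset_subP; exact: LE].
- by split; auto; [apply/sumset_dilate_subP; exact: ES|apply/sumset_subP;
  exact: SE].
- have [l0 hc] := hlg; have [h1 h2] := kL _ l0 hc;
  have eS : S = generated S by apply/SG/hsh.
  rewrite -eS; split=> //; first by apply: Lgrp => //; apply/hol.
  by move=> _ [x Sx <-]; rewrite -[_ *: x]addr0; apply: h1; exists (2 *: x);
    [exists x|exists 0; auto].
- have [l0 hc] := hlg; have [h1 h2] := kL _ l0 hc;
  have eS : S = generated S by apply/SG/hsh.
  rewrite -eS; split=> //; first by apply: Lgrp => //; apply/hol.
  by move=> _ [x Sx <-]; rewrite -[_ *: x]addr0; apply: h1; exists (3 *: x);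
    [exists x|exists 0; auto].
Qed.

(** The conditions require the shifts of a class to form a group exactly when
    the profile grants this class an obtuse pair, so they supply all the
    addition laws of a shift system. *)
Lemma type_conditions_system t : is_of_type form Delta t ->
  chain_condition form Delta S L E ->
  type_conditions form t Delta S L E (generated S) -> shift_system form Delta S L E.
Proof.
move=> tD [[S_n0 SV] hL hE] cond; have [hlg hex hsh hol] := type_profile tD.
have [a sa] := short_root_exists rsys;
  have a0 := root_norm_neq0 rsys (short_root sa).
have sG := generated_subgroup S.
have nolg : lg = set0 -> ~ (lg !=set0) by move=> -> [].
have noex : ex = set0 -> ~ (ex !=set0) by move=> -> [].
have noobt : lg = set0 -> ~ has_obtuse_pair form lg by move=> -> [b [c []]].
have ratio c k b d : (forall a b, sh a -> lg b -> form b b = c * form a a) ->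
    sh b -> lg d -> form d d = k * form b b -> k = c.
  move=> hc sb ld; rewrite (hc _ _ sb ld) => /mulIf-> //.
  exact: (root_norm_neq0 rsys (short_root sb)).
have nolgk b d k : lg = set0 -> sh b -> lg d -> form d d = k * form b b ->
    forall x y, S x -> L y -> L (k *: x + y).
  by move=> -> _ [].
(* the simply laced types, where S is a group *)
have laced : lg = set0 -> ex = set0 -> S = generated S ->
    shift_system form Delta S L E.
  move=> lg0 ex0 SG; have sS : subgroup S by rewrite SG.
  split; try (by move=> /(nolg lg0)) || (by move=> /(noex ex0))
    || (by move=> /(noobt lg0)).
  - by case: sS.
  - exact: subgroup_reflection.
  - by move=> b d k; exact: nolgk.
  - by move=> _ x y; exact: subgroupD.
case: t tD cond hlg hex hsh hol => [J|J|J|J||||J|||] tD /= cond hlg hex hsh hol.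
- have [[/reflection_spaceP[_ S2] S0] nA1] := cond.
  case: (pselect (root_iso form Delta (dot 'I_2) (rootA 'I_2))) => [A1|/nA1];
    last exact: laced.
  split; try (by move=> /(nolg hlg)) || (by move=> /(noex hex)) || (by move=>
    /(noobt hlg)).
  + exact: S0.
  + exact: S2.
  + by move=> b d k; exact: nolgk.
  + by move=> /(A1_not_obtuse A1).
- case: cond => -[/reflection_spaceP[_ S2] S0] [/reflection_spaceP[_ L2] L0].
  move=> /sumset_dilate_subP kSL /sumset_subP SL Lgrp; have [_ hc] := hlg.
  split; try (by move=> /(noex hex)) || (by move=> _ /(noex hex)); auto.
  + by move=> b d k sb ld /(ratio _ _ _ _ hc sb ld) ->; exact: kSL.
  + by move=> /hsh.
  + by move=> /hol/Lgrp sL x y; exact: subgroupD.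
- case: cond => -[/reflection_spaceP[_ S2] S0] [/reflection_spaceP[_ L2] L0].
  move=> /sumset_dilate_subP kSL /sumset_subP SL SG; have [_ hc] := hlg.
  split; try (by move=> /(noex hex)) || (by move=> _ /(noex hex)); auto.
  + by move=> b d k sb ld /(ratio _ _ _ _ hc sb ld) ->; exact: kSL.
  + by move=> /hsh/SG -> x y; exact: subgroupD.
  + by move=> /hol.
- exact: laced.
- exact: laced.
- exact: laced.
- exact: laced.
- case: cond => -[[/reflection_spaceP[_ S2] S0] [/reflection_spaceP[_ L2] L0]].
  move=> /reflection_spaceP[_ E2] [/sumset_dilate_subP kSL /sumset_subP SL].
  move=> [/sumset_dilate_subP kSE /sumset_subP SE] [/sumset_dilate_subP kLE
    /sumset_subP LE].
  move=> Lgrp; have [_ hc] := hlg; split; auto.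
  + by move=> b d k sb ld /(ratio _ _ _ _ hc sb ld) ->; exact: kSL.
  + by move=> /hsh.
  + by move=> /hol/Lgrp sL x y; exact: subgroupD.
- case: cond => -[/reflection_spaceP[_ S2] S0] /reflection_spaceP[_ E2].
  move=> /sumset_dilate_subP kSE /sumset_subP SE.
  split; try (by move=> /(nolg hlg)) || (by move=> /(noobt hlg)); auto.
  + by move=> b d k; exact: nolgk.
  + by move=> /hsh.
- have [SG sL kS] := cond; have [l0 hc] := hlg; have sS : subgroup S by rewrite SG.
  have [_ LS] := hL l0; split;
    try (by move=> /(noex hex)) || (by move=> _ /(noex hex)).
  + by case: sS.
  + exact: subgroup_reflection.
  + by move=> _; exact: subgroup_reflection.
  + by move=> _ x y Sx /LS; exact: subgroupD.
  + move=> b d k sb ld /(ratio _ _ _ _ hc sb ld) -> x y Sx; apply: subgroupD => //.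
    by apply: kS; exists x; rewrite // -SG.
  + by move=> _ x y; exact: subgroupD.
  + by move=> _ x y; exact: subgroupD.
- have [SG sL kS] := cond; have [l0 hc] := hlg; have sS : subgroup S by rewrite SG.
  have [_ LS] := hL l0; split;
    try (by move=> /(noex hex)) || (by move=> _ /(noex hex)).
  + by case: sS.
  + exact: subgroup_reflection.
  + by move=> _; exact: subgroup_reflection.
  + by move=> _ x y Sx /LS; exact: subgroupD.
  + move=> b d k sb ld /(ratio _ _ _ _ hc sb ld) -> x y Sx; apply: subgroupD => //.
    by apply: kS; exists x; rewrite // -SG.
  + by move=> _ x y; exact: subgroupD.
  + by move=> _ x y; exact: subgroupD.
Qed.
End Types.

(** * The theorem *)

Section Forward.
Variables (V : lmodType rat) (form : {symmetric V}) (R W : set V).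
Hypothesis RL : is_lears form [set: V] R.
Hypothesis RW : is_reflectable_subspace form R W.
Local Notation V0 := (radical form).
Local Notation Delta := (root_part form R W).
Local Notation sh := (short_roots form Delta).
Local Notation lg := (long_roots form Delta).
Local Notation ex := (extra_long_roots form Delta).
Local Notation S := (shift_union form R sh).
Local Notation L := (shift_union form R lg).
Local Notation E := (shift_union form R ex).

Let sW : subspace W := reflectable_subspace RW.
Let dW : direct_sum W V0 := reflectable_direct_sum RL RW.
Let rsys : is_lf_irr_root_system form W Delta := root_part_system RL sW dW.
Let ssys : shift_system form Delta S L E := shifts_system RL RW.

Lemma shift_union_radical (C : set V) : shift_union form R C `<=` V0.
Proof. by move=> s [a _ []]. Qed.

Lemma shift_union_neq0 (C : set V) : C `<=` Delta -> C !=set0 ->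
  shift_union form R C !=set0.
Proof. by move=> CD [a Ca]; have [_ [s Ts]] := CD _ Ca; exists s, a. Qed.

Lemma shifts_chain : chain_condition form Delta S L E.
Proof.
have S0 := short_shifts0 RL RW.
have SL := shift_SL ssys; have SE := shift_SE ssys; have LE := shift_LE ssys.
split; first by split; [exists 0|exact: shift_union_radical].
  move=> l0; split; first exact: shift_union_neq0 (@long_root _ _ _) l0.
  by move=> x Lx; rewrite -[x]add0r; exact: SL.
move=> x0; split; first exact: shift_union_neq0 (@extra_root _ _ _) x0.
  by move=> x Ex; rewrite -[x]add0r; exact: SE.
by move=> l0 x Ex; rewrite -[x]add0r; apply: LE => //; exact: long_shifts0.
Qed.

Lemma union_root_shifts : \bigcup_(a in Delta) root_shifts form R a = S.
Proof.
have [_ LS ES] := shifts_chain.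
apply/seteqP; split=> [s [a Da Ts]|s [a [Da _] Ts]]; last by exists a.
have [sa|la|xa] := root_class form Da; first by exists a.
  by have [_ sub] := LS (ex_intro _ a la); apply: sub; exists a.
by have [_ sub _] := ES (ex_intro _ a xa); apply: sub; exists a.
Qed.

(** R, hence V, is contained in W + span S. *)
Lemma short_shifts_span : lin_span S = V0.
Proof.
have sS := lin_span_subspace S.
apply/seteqP; split;
  first exact: (lin_span_sub (radical_subspace form) (@shift_union_radical _)).
move=> x Vx; have : sumset W (lin_span S) x.
  have : lin_span R x by case: RL => _ _ _ _ -> *.
  apply: lin_span_sub => [|y Ry]; first exact: sumset_subspace.
  have [v [r [Wv Vr e]]] := direct_sum_ex dW y; exists v => //; exists r => //.
  apply: sub_lin_span; rewrite -union_root_shifts; exists v; rewrite e in Ry;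
    last by [].
  by split=> //; exists r.
move=> [w Ww [s Ss e]]; have W0 : W 0 by case: sW.
have Vs : V0 s.
  by move: s Ss {e}; exact: (lin_span_sub (radical_subspace form)
    (@shift_union_radical _)).
have e' : w + s = 0 + x by rewrite e add0r.
by have [_ <-] := direct_sum_inj sW dW Ww W0 Vs Vx e'.
Qed.

Lemma long_shifts_span : lg !=set0 -> lin_span L = V0.
Proof.
move=> l0; apply/seteqP; split.
  exact: (lin_span_sub (radical_subspace form) (@shift_union_radical _)).
rewrite -short_shifts_span; have [b lb] := l0;
  have [a sa] := short_root_exists rsys.
have L0 := long_shifts0 RL RW l0.
have [e|e] := long_norm rsys sa lb.
  by apply: (@lin_span_affine _ _ _ 2 0) => // x Sx; exact: (shift_LS ssys sa lb e).
by apply: (@lin_span_affine _ _ _ 3 0) => // x Sx; exact: (shift_LS ssys sa lb e).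
Qed.

Lemma extra_shifts_span : ex !=set0 -> lin_span E = V0.
Proof.
move=> x0; apply/seteqP; split.
  exact: (lin_span_sub (radical_subspace form) (@shift_union_radical _)).
rewrite -short_shifts_span; have [y Ey] := shift_union_neq0 (@extra_root _ _ _) x0.
by apply: (@lin_span_affine _ _ _ 4 y) => // x Sx; exact: (shift_ES ssys).
Qed.

(** If e = 2 s with s a shift of the short root b and e a shift of 2 b, then
    b + s and 2 (b + s) are both in R. *)
Lemma reduced_extra_shifts : is_reduced R -> E `&` dilate 2 S = set0.
Proof.
move=> red; apply/seteqP; split=> // x [[a [Da [b sb ab]] Ta] [s Ss e]].
move: Ss; rewrite -(short_shiftsE RL RW sb) => -[Vs Rbs].
by apply: (red _ Rbs); rewrite scalerDr e -ab; case: Ta.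
Qed.

Lemma shifts_type t : is_of_type form Delta t ->
  type_conditions form t Delta S L E (generated S).
Proof.
move=> tD; apply: (system_type_conditions rsys tD) => //.
- exact: shift_union_radical.
- by move=> _; exact: shift_union_radical.
- by move=> _; exact: shift_union_radical.
- exact: long_shifts0.
Qed.

Lemma lears_decomposition t : is_of_type form Delta t ->
  R = union_of (type_pieces form t Delta S L E (generated S)) /\
  pairwise_disjoint (type_pieces form t Delta S L E (generated S)).
Proof.
move=> tD; rewrite (type_pieces_G (shifts_type tD)) (pieces_union rsys)//.
split; first exact: lears_shifted_roots.
by apply: (pieces_disjoint rsys) => // [|_|_]; exact: shift_union_radical.
Qed.

End Forward.

Lemma converse_construction (V : lmodType rat) (form : {symmetric V})
    (W Delta S L E : set V) (t : root_type) :
  direct_sum W (radical form) -> is_lf_irr_root_system form W Delta ->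
  is_of_type form Delta t -> chain_condition form Delta S L E ->
  lin_span S = radical form ->
  type_conditions form t Delta S L E (generated S) ->
  let R := union_of (type_pieces form t Delta S L E (generated S)) in
  is_lears form [set: V] R /\ has_type form R Delta.
Proof.
move=> dW rsys tD chain spS cond R.
have ssys := type_conditions_system rsys tD chain cond.
have -> : R = shifted_roots Delta (class_shift form Delta S L E).
  by rewrite /R (type_pieces_G cond) (pieces_union rsys).
have [[S_n0 SV] hL hE] := chain.
have cases a : Delta a -> class_shift form Delta S L E a !=set0 /\
    class_shift form Delta S L E a `<=` radical form.
  move=> Da; have [sa|la|xa] := root_class form Da.
  - by rewrite (class_shift_short _ _ _ rsys sa).
  - have [Ln0 LS] := hL (ex_intro _ a la).
    by rewrite (class_shift_long _ _ _ rsys la); split=> // x /LS/SV.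
  - have [En0 ES _] := hE (ex_intro _ a xa).
    by rewrite (class_shift_extra _ _ _ rsys xa); split=> // x /ES/SV.
have Tn0 a : Delta a -> class_shift form Delta S L E a !=set0 by move=> /cases[].
have TV0 a : Delta a -> class_shift form Delta S L E a `<=` radical form
  by move=> /cases[].
have Tr a b s r : Delta a -> Delta b -> class_shift form Delta S L E a s ->
    class_shift form Delta S L E b r ->
    class_shift form Delta S L E (reflection form a b) (r - cartan form b a *: s).
  move=> Da Db Ts Tt; rewrite (class_shift_reflection _ _ _ rsys)//.
  exact: (class_shift_closed rsys ssys).
split; last exact: (shifted_roots_type rsys dW TV0 Tn0).
apply: (shifted_roots_lears rsys dW TV0 Tn0 Tr); rewrite -spS.
have sR := lin_span_subspace (shifted_roots Delta (class_shift form Delta S L E)).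
apply: lin_span_sub => // s Ss; have [a sa] := short_root_exists rsys.
have inR r : S r -> shifted_roots Delta (class_shift form Delta S L E) (a + r).
  by move=> Sr; exists a, r; split=> //; [exact: (short_root sa)|exact: Or31].
have -> : s = (a + s) - (a + 0) by rewrite addr0 addrC addKr.
by apply: (subspaceB sR); apply: sub_lin_span; apply: inR => //;
  exact: (shift_S0 ssys).
Qed.

Theorem theorem7 :
  (forall (V : lmodType rat) (form : {symmetric V}) (R V' : set V),
    is_lears form [set: V] R ->
    is_reflectable_subspace form R V' ->
    let V0 := radical form in
    let Delta := root_part form R V' in
    let G := generated (\bigcup_(a in Delta) root_shifts form R a) in
    exists S L E : set V,
      [/\ forall a, short_roots form Delta a -> root_shifts form R a = S,
          forall a, long_roots form Delta a -> root_shifts form R a = L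
        & forall a, extra_long_roots form Delta a -> root_shifts form R a = E] /\
      [/\ chain_condition form Delta S L E,
          generated S = G,
          lin_span S = V0,
          long_roots form Delta !=set0 -> lin_span L = V0
        & extra_long_roots form Delta !=set0 -> lin_span E = V0] /\
      forall t : root_type, is_of_type form Delta t ->
        [/\ R = union_of (type_pieces form t Delta S L E G),
            pairwise_disjoint (type_pieces form t Delta S L E G),
            type_conditions form t Delta S L E G
          & is_BC t -> is_reduced R -> E `&` dilate 2 S = set0]) /\
  (forall (V : lmodType rat) (form : {symmetric V}) (V' Delta S L E : set V)
      (t : root_type),
    let V0 := radical form in
    direct_sum V' V0 ->
    is_lf_irr_root_system form V' Delta ->
    is_of_type form Delta t ->
    chain_condition form Delta S L E ->
    lin_span S = V0 ->
    let G := generated S in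
    type_conditions form t Delta S L E G ->
    let R := union_of (type_pieces form t Delta S L E G) in
    is_lears form [set: V] R /\ has_type form R Delta).
Proof.
split=> [V form R W RL RW V0 Delta G|V form W Delta S L E t V0 dW rsys tD chain
  spS G cond R];
  last exact: (converse_construction dW rsys tD chain spS cond).
exists (shift_union form R (short_roots form Delta)),
  (shift_union form R (long_roots form Delta)),
  (shift_union form R (extra_long_roots form Delta)).
rewrite /G union_root_shifts//; split; last split.

- by split=> a; [exact: (short_shiftsE RL RW)|exact: (long_shiftsE RL RW)|
  exact: (extra_shiftsE RL RW)].
- split=> //; [exact: (shifts_chain RL RW)|exact: (short_shifts_span RL RW)|
  exact: (long_shifts_span RL RW)|].
  exact: (extra_shifts_span RL RW).
- move=> t tD; have [RE dis] := lears_decomposition RL RW tD.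
  split=> //; first exact: (shifts_type RL RW).
  by move=> _; exact: (reduced_extra_shifts RL RW).
Qed.
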